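(* Let $G$ be given by a $C'(1/6)$ or $C'(1/4)-T(4)$ presentation $\langle\mathbf{x};\mathbf{r}\rangle$. Suppose that $\langle\mathbf{x};\mathbf{r},\mathbf{s}\rangle$ is a $C'(1/4)$ presentation. Then every non-empty word over $\mathbf{s}$ which is freely reduced over $\mathbf{s}$ is cyclically $\mathbf{r}^{\ast}$-reduced, and hence $\langle\mathbf{s}\rangle_G$ is a free subgroup of $\langle\mathbf{x};\mathbf{r}\rangle$ with basis $\mathbf{s}$.
   Context: All presentations are countable. $\mathbf{s}\subset F(\mathbf{x})$, and $\langle\mathbf{s}\rangle_G$ denotes the subgroup of $G$ generated by the words $\mathbf{s}$. Small cancellation conditions (as in Lyndon--Schupp, Chapter V): for a set $\mathbf{u}$ of non-trivial cyclically reduced words in $F(\mathbf{x})$, $\mathbf{u}^{\ast}$ denotes its symmetrised closure, i.e. the set of all cyclic shifts of elements of $\mathbf{u}$ and of their inverses. A piece is a non-empty word which is a common initial segment of two distinct elements of $\mathbf{u}^{\ast}$. Condition $C'(\lambda)$: if $R\in\mathbf{u}^{\ast}$ has an initial segment $P$ which is a piece then $|P|<\lambda|R|$. Condition $T(4)$: for all $R_1,R_2,R_3\in\mathbf{u}^{\ast}$ with $R_2\neq R_1^{-1}$, $R_3\neq R_2^{-1}$ and $R_1\neq R_3^{-1}$, at least one of the products $R_1R_2$, $R_2R_3$, $R_3R_1$ is reduced without cancellation. A presentation $\langle\mathbf{x};\mathbf{u}\rangle$ satisfies these conditions when $\mathbf{u}$ does; for $\langle\mathbf{x};\mathbf{r},\mathbf{s}\rangle$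 one takes $\mathbf{u}=\mathbf{r}\cup\mathbf{s}$. A word $U$ in $\mathbf{x}^{\pm1}$ is $\mathbf{r}^{\ast}$-reduced if it is freely reduced and has no subword $W$ such that $W$ is a subword of some $R\in\mathbf{r}^{\ast}$ with $|W|>\frac12|R|$. A word $U$ (not necessarily reduced) is cyclically $\mathbf{r}^{\ast}$-reduced if every free reduction (over $\mathbf{x}$) of every cyclic shift of $U$ is non-empty and $\mathbf{r}^{\ast}$-reduced. A word over $\mathbf{s}$ means a word over the set $\mathbf{s}^{\pm1}$; it is freely reduced over $\mathbf{s}$ if, as a formal word in the symbols $\mathbf{s}^{\pm1}$, it contains no subword $SS^{-1}$ or $S^{-1}S$ with $S\in\mathbf{s}$ (it need not be freely reduced when regarded as a word over $\mathbf{x}^{\pm1}$).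
   Formalization: Two assumptions are added, without which the claim fails: no element of s lies in r* (else it is trivial in G, e.g. r = s = {a}), and s never contains both S and its inverse (else s is not a basis, e.g. r empty, s = {a, a^-1}). *)

(* Defs.v *)
From HB Require Import structures.
From Stdlib Require Import Relation_Operators.
From mathcomp Require Import all_boot all_order all_algebra generic_quotient.
From mathcomp Require Import boolp classical_sets.

Set Implicit Arguments.
Unset Strict Implicit.
Unset Printing Implicit Defensive.

Local Open Scope classical_set_scope.
Local Open Scope quotient_scope.

(* The letter (x, true) stands for x and (x, false) for its formal inverse.
   A word need not be freely reduced. *)
Definition letter (X : Type) : Type := (X * bool)%type.
Definition word (X : Type) : Type := seq (letter X).

Definition linv (X : Type) (a : letter X) : letter X := (a.1, ~~ a.2).
Definition winv (X : Type) (w : word X) : word X := rev (map (@linv X) w).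

Definition reduced (X : eqType) (w : word X) : bool :=
  sorted [rel a b | b != linv a] w.

(* [cycle] also compares the last letter with the first one. *)
Definition cyc_reduced (X : eqType) (w : word X) : bool :=
  cycle [rel a b | b != linv a] w.

Inductive cancel_step (X : Type) : word X -> word X -> Prop :=
  CancelStep (p q : word X) (a : letter X) :
    cancel_step (p ++ [:: a; linv a] ++ q) (p ++ q).

Definition free_reduction (X : eqType) (u v : word X) : Prop :=
  clos_refl_trans _ (@cancel_step X) u v /\ reduced v.

Section SmallCancellation.
Variable X : eqType.
Implicit Types (u r s : set (word X)) (w p R : word X).

Definition relator_set u : Prop :=
  forall w, u w -> w <> [::] /\ cyc_reduced w.

Definition symm_closure u : set (word X) :=
  [set w | exists2 v, u v & exists n, w = rot n v \/ w = rot n (winv v)].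

Definition piece u p : Prop :=
  p <> [::] /\
  exists w1 w2, [/\ symm_closure u w1, symm_closure u w2, w1 <> w2,
                    prefix p w1 & prefix p w2].

Definition C' (lambda : rat) u : Prop :=
  forall R p, symm_closure u R -> prefix p R -> piece u p ->
    ((size p)%:R < lambda * (size R)%:R)%R.

(* The elements of the symmetrised closure of a relator set are reduced, so a
   product is reduced without cancellation when the concatenation is reduced. *)
Definition T4 u : Prop :=
  forall R1 R2 R3, symm_closure u R1 -> symm_closure u R2 -> symm_closure u R3 ->
    R2 <> winv R1 -> R3 <> winv R2 -> R1 <> winv R3 ->
    [\/ reduced (R1 ++ R2), reduced (R2 ++ R3) | reduced (R3 ++ R1)].

Definition star_reduced r w : Prop :=
  reduced w /\
  ~ exists V R, [/\ infix V w, symm_closure r R, infix V R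
                  & ((size R)%:R / 2%:R < (size V)%:R :> rat)%R].

Definition cyc_star_reduced r w : Prop :=
  forall n v, free_reduction (rot n w) v -> v <> [::] /\ star_reduced r v.

End SmallCancellation.

Definition word_letter (X : eqType) (s : set (word X)) (a : letter s) : word X :=
  if a.2 then val a.1 else winv (val a.1).

(* A word over s is a formal word on the alphabet s; [expand] reads it as a
   word over X, without any cancellation. *)
Definition expand (X : eqType) (s : set (word X)) (w : word s) : word X :=
  flatten (map (@word_letter X s) w).

Section Presented.
Variables (X : choiceType) (r : set (word X)).
Implicit Types u v w : word X.

Inductive pres_step : word X -> word X -> Prop :=
  | PresCancel u v : cancel_step u v -> pres_step u v
  | PresRelator p q R : r R -> pres_step (p ++ R ++ q) (p ++ q).

Definition pres_eq u v : bool := `[< clos_refl_sym_trans _ pres_step u v >].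

Fact pres_eq_refl : reflexive pres_eq.
Proof. by move=> u; apply/asboolP; apply: rst_refl. Qed.

Fact pres_eq_sym : symmetric pres_eq.
Proof.
by move=> u v; apply/asboolP/asboolP => uv; apply: rst_sym.
Qed.

Fact pres_eq_trans : transitive pres_eq.
Proof.
move=> v u w /asboolP uv /asboolP vw; apply/asboolP.
exact: rst_trans uv vw.
Qed.

Canonical pres_equiv := EquivRel pres_eq pres_eq_refl pres_eq_sym pres_eq_trans.

(* The group presented by <X; r>: words modulo insertion and deletion of
   a a^-1 and of relators. *)
Definition presented : Type := {eq_quot pres_equiv}.
HB.instance Definition _ := Choice.on presented.
HB.instance Definition _ := EqQuotient.on presented.

Definition pres_class (w : word X) : presented := \pi_presented w.

Fact pres_classP u v : reflect (pres_class u = pres_class v) (pres_eq u v).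
Proof. by apply: (iffP idP) => [?|]; [apply/eqmodP | move/eqmodP]. Qed.

Lemma pres_step_catl w u v : pres_step u v -> pres_step (w ++ u) (w ++ v).
Proof.
case=> [_ _ [p q a]|p q R rR]; last by rewrite !catA -catA; apply: PresRelator.
by rewrite !(catA w); apply/PresCancel/CancelStep.
Qed.

Lemma pres_step_catr w u v : pres_step u v -> pres_step (u ++ w) (v ++ w).
Proof.
case=> [_ _ [p q a]|p q R rR]; rewrite -!catA; last exact: PresRelator.
exact/PresCancel/CancelStep.
Qed.

Lemma linvK : involutive (@linv X).
Proof. by case=> x b; rewrite /linv /= negbK. Qed.

Lemma cancel_stepV (p q : word X) a :
  cancel_step (p ++ linv a :: a :: q) (p ++ q).
Proof. by have := CancelStep p q (linv a); rewrite linvK. Qed.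

Lemma pres_step_inv u v : pres_step u v ->
  clos_refl_sym_trans _ pres_step (winv u) (winv v).
Proof.
case=> [_ _ [p q a]|p q R rR]; rewrite /winv !map_cat !rev_cat.
  rewrite -catA; apply: rst_step; apply: PresCancel.
  have -> : rev [seq linv b | b <- [:: a; linv a]] = [:: a; linv a].
    by rewrite /= linvK.
  exact: CancelStep.
rewrite -catA.
set P := rev _; set R' := rev _; set Q := rev _.
have del n T : size T = n -> clos_refl_sym_trans _ pres_step
    (P ++ rev (map (@linv X) T) ++ T ++ Q) (P ++ Q).
  elim: n T => [[] // _|n IH [//|a T] [sT]]; first exact: rst_refl.
  rewrite /= rev_cons -cats1 -!catA.
  apply: rst_trans (IH _ sT).
  rewrite !(catA P); apply: rst_step; apply: PresCancel.
  exact: cancel_stepV.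
apply: rst_trans (del _ R erefl).
apply: rst_sym; apply: rst_step; rewrite !(catA P).
exact: PresRelator.
Qed.

Lemma pres_clos_map (f : word X -> word X) u v :
  (forall u v, pres_step u v -> clos_refl_sym_trans _ pres_step (f u) (f v)) ->
  clos_refl_sym_trans _ pres_step u v ->
  clos_refl_sym_trans _ pres_step (f u) (f v).
Proof.
move=> fP; elim=> [{}u {}v /fP //|{}u|{}u {}v _ uv|{}u {}v w _ uv _ vw].
- exact: rst_refl.
- exact: rst_sym.
- exact: rst_trans uv vw.
Qed.

Lemma pres_eq_cat u u' v v' :
  pres_eq u u' -> pres_eq v v' -> pres_eq (u ++ v) (u' ++ v').
Proof.
move=> /asboolP uu' /asboolP vv'; apply/asboolP.
apply: rst_trans (_ : clos_refl_sym_trans _ pres_step _ (u' ++ v)) _.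
  apply: (pres_clos_map (f := cat^~ v)) uu' => a b ab.
  exact/rst_step/pres_step_catr.
apply: (pres_clos_map (f := cat u')) vv' => a b ab.
exact/rst_step/pres_step_catl.
Qed.

Lemma pres_eq_inv u v : pres_eq u v -> pres_eq (winv u) (winv v).
Proof.
move=> /asboolP uv; apply/asboolP.
by apply: pres_clos_map uv => a b; apply: pres_step_inv.
Qed.

Lemma pres_eq_Vl u : pres_eq (winv u ++ u) [::].
Proof.
apply/asboolP; elim: u => [|a u IH]; first exact: rst_refl.
rewrite /winv /= rev_cons -cats1 -catA.
apply: rst_trans IH; apply: rst_step; apply: PresCancel.
exact: cancel_stepV.
Qed.

Lemma winvK : involutive (@winv X).
Proof.
by move=> w; rewrite /winv map_rev revK -map_comp (eq_map linvK) map_id.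
Qed.

Definition pres_one : presented := pres_class [::].
Definition pres_mul (g h : presented) : presented :=
  pres_class (repr g ++ repr h).
Definition pres_inv (g : presented) : presented := pres_class (winv (repr g)).

Lemma pres_classK (g : presented) : pres_class (repr g) = g.
Proof. exact: reprK. Qed.

Lemma pres_class_cat u v :
  pres_mul (pres_class u) (pres_class v) = pres_class (u ++ v).
Proof.
by apply/pres_classP/pres_eq_cat; apply/pres_classP; rewrite pres_classK.
Qed.

Lemma pres_class_inv u : pres_inv (pres_class u) = pres_class (winv u).
Proof. by apply/pres_classP/pres_eq_inv/pres_classP; rewrite pres_classK. Qed.

Fact pres_mulA : associative pres_mul.
Proof.
move=> f g h; rewrite -[f]pres_classK -[g]pres_classK -[h]pres_classK.
by rewrite !pres_class_cat catA.
Qed.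

Fact pres_mul1 : left_id pres_one pres_mul.
Proof. by move=> g; rewrite -[g]pres_classK pres_class_cat. Qed.

Fact pres_mulr1 : right_id pres_one pres_mul.
Proof. by move=> g; rewrite -[g]pres_classK pres_class_cat cats0. Qed.

Fact pres_mulV : left_inverse pres_one pres_inv pres_mul.
Proof.
move=> g; rewrite -[g]pres_classK pres_class_inv pres_class_cat.
exact/pres_classP/pres_eq_Vl.
Qed.

Fact pres_mulrV : right_inverse pres_one pres_inv pres_mul.
Proof.
move=> g; rewrite -[g]pres_classK pres_class_inv pres_class_cat.
by apply/pres_classP; rewrite -{1}[repr g]winvK; apply: pres_eq_Vl.
Qed.

HB.instance Definition _ := isGroup.Build presented
  pres_mulA pres_mul1 pres_mulr1 pres_mulV pres_mulrV.

End Presented.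

Local Open Scope group_scope.

Definition is_subgroup (G : groupType) (H : set G) : Prop :=
  [/\ H 1, forall x y, H x -> H y -> H (x * y) & forall x, H x -> H x^-1].

Definition subgroup_gen (G : groupType) (A : set G) : set G :=
  smallest [set H | is_subgroup H] A.

(* The subgroup H of G is free with basis (b i), i in I: every map from I to a
   group extends uniquely to a homomorphism on H.  A homomorphism on H is
   represented by a function on G, of which only the values on H matter. *)
Definition free_with_basis (G : groupType) (H : set G) (I : Type) (b : I -> G)
    : Prop :=
  (forall i, H (b i)) /\
  forall (K : groupType) (f : I -> K),
    (exists phi : G -> K,
      {in H &, {morph phi : x y / x * y}} /\ forall i, phi (b i) = f i) /\
    forall phi psi : G -> K,
      {in H &, {morph phi : x y / x * y}} -> (forall i, phi (b i) = f i) ->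
      {in H &, {morph psi : x y / x * y}} -> (forall i, psi (b i) = f i) ->
      {in H, phi =1 psi}.

(* Main.v *)
Require Import Defs.
From Stdlib Require Import Relation_Operators.
From mathcomp Require Import all_boot all_order all_algebra all_fingroup zify.
From mathcomp Require Import boolp classical_sets.

(** Why the theorem holds.

    Write a word over s as a product of words T a, one for each formal letter
    a.  Two different words T a and T b have less than a quarter of either in
    common as prefixes, because a common prefix is a piece; hence when such a
    product is freely reduced, every inner factor loses less than a quarter at
    each end, and more than half of it survives.  A common subword of some T a
    and of a relator R of r is also a piece, since no cyclic shift of T a is a
    relator.  A subword of R therefore cannot contain a surviving factor, so it
    meets at most two of them, in less than a quarter of R each
    ([chain_overlap]).  Reading the product from an arbitrary point only adds a
    suffix of a factor at the beginning and a prefix of a factor at the end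
    ([red_star_reduced_rotation]), and this gives the first claim,
    [expand_cyc_star_reduced].

    For the second claim one needs that a cyclically r*-reduced word is not
    trivial in the group ([cyc_star_reduced_neq1]), which is Dehn's algorithm
    in the form due to Greendlinger.  The proof is the curvature argument on
    van Kampen diagrams.  A diagram is a map on the sphere: a finite set of
    oriented edges (darts) with a fixed-point-free involution e that reverses
    edges and a permutation f whose cycles are the faces; the cycles of e * f
    are the vertices.  One face, the outer one, reads the given word and the
    others read relators.  Being a sphere is a condition on the numbers of
    vertices, edges, faces and components ([planar]), so that cutting and
    pasting reduces to counting the cycles of a permutation multiplied by a
    transposition.  The words that bound a diagram are invariant under the
    moves of the presentation ([bounds_or_nil_step]), so every non-empty
    trivial word bounds one ([bounds_trivial]).  Take a diagram with as few darts as
    possible: it contains no two cells that are mirror images across an edge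
    ([diagram_mirror]).  Then an arc between two cells is a piece, and an
    arc between a cell and the outer face is at most half of the cell.  Give
    every corner an angle that depends only on the degree of its vertex and on
    the number of outer corners there ([angle]).  Angles at a vertex add up to
    at least 2 pi ([vertex_angle]), and the turning along an inner face is at
    least 2 pi ([face_defect]): away from the boundary a face has at
    least seven corners of angle 2 pi / 3 under C'(1/6), and at least five of
    angle pi / 2 under C'(1/4)-T(4); a face with a boundary arc has fewer, but
    it turns by pi / 2 more at each end of such an arc.  A sphere has Euler characteristic 2, of which the
    outer face accounts for only 1, so this is impossible
    ([no_reduced_diagram]).

    Freeness follows: a reduced non-empty word over s is not trivial, so the
    value of a word over s in any group depends only on its class
    ([ev_well_defined]). *)

Set Implicit Arguments.
Unset Strict Implicit.
Unset Printing Implicit Defensive.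

(** * Orbits of a permutation *)

Section Orbits.
Variable D : finType.
Implicit Types (s f : {perm D}) (x y : D).

Lemma card_porbits_tperm s x y : x != y ->
  #|porbits (s * tperm x y)%g| + (x \notin porbit s y).*2 = #|porbits s| + 1.
Proof.
move=> xy; rewrite -porbitsV invMg tpermV -[in RHS]porbitsV -porbitV.
by rewrite porbits_mul_tperm xy.
Qed.

Lemma card_porbits_split s x y : x != y -> x \in porbit s y ->
  #|porbits (s * tperm x y)%g| = #|porbits s|.+1.
Proof. by move=> xy sxy; have := card_porbits_tperm s xy; rewrite sxy; lia. Qed.

(** The cycles of y and x are distinct and become one, which is what the second
    component records: it links x to y when a colouring has to be transported. *)
Lemma card_porbits_merge s x y : x \notin porbit s y ->
  #|porbits (s * tperm x y)%g|.+1 = #|porbits s|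
  /\ x \in porbit (s * tperm x y)%g y.
Proof.
move=> sxy; have xy : x != y by apply: contraNneq sxy => ->; exact: porbit_id.
have := card_porbits_tperm s xy; rewrite sxy /= => E1.
have := card_porbits_tperm (s * tperm x y)%g xy.
rewrite -mulgA tperm2 mulg1; case: (x \in _) => /=; lia.
Qed.

Lemma porbit_invariant (T : Type) (c : D -> T) s :
  (forall x, c (s x) = c x) -> forall x y, x \in porbit s y -> c x = c y.
Proof.
move=> cs x y /porbitP [i ->]; rewrite permX.
by elim: i => //= i IH; rewrite cs.
Qed.

Lemma porbit_step s x : s x \in porbit s x.
Proof. exact: (mem_porbit s 1). Qed.

Lemma porbit_stepE s x : porbit s (s x) = porbit s x.
Proof. by apply/eqP; rewrite eq_porbit_mem porbit_step. Qed.

Lemma porbit_step_notin s x y z : x \notin porbit s y -> z \in porbit s x ->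
  s z \notin porbit s y.
Proof.
by rewrite -!eq_porbit_mem porbit_stepE => xy /eqP ->.
Qed.

Lemma traject_porbit_fcycle f x p : uniq (x :: p) -> fcycle f (x :: p) ->
  traject f x #|porbit f x| = x :: p.
Proof.
move=> Up Cp; have := Cp; rewrite /= => /fpathE; rewrite size_rcons trajectSr.
move=> /rcons_inj [Ep Ex].
have Et : traject f x (size p).+1 = x :: p by rewrite trajectS -Ep.
suff -> : #|porbit f x| = (size p).+1 by [].
rewrite -[(size p).+1]/(size (x :: p)) -(card_uniqP Up); apply: eq_card => z.
apply/idP/idP => [/porbitP [i ->]|].
  rewrite permX; elim: i => [|i IH]; first exact: mem_head.
  exact: (mem_fcycle Cp).
by rewrite -Et => /trajectP [i _ ->]; rewrite -permX mem_porbit.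
Qed.

Lemma fcycle_traject_porbit f x : fcycle f (traject f x #|porbit f x|).
Proof.
have := iter_porbit f x; case: #|porbit f x| => //= n nx.
by rewrite rcons_path fpath_traject last_traject /= nx.
Qed.

(** Used to bound numbers of cycles from below. *)
Lemma card_invariant (T : finType) (c : D -> T) s :
  (forall x, c (s x) = c x) -> #|[set c x | x in D]| <= #|porbits s|.
Proof.
move=> cs; case: (posnP #|D|) => [D0|/card_gt0P [x0 _]].
  by apply: leq_trans (leq_imset_card _ _) _; rewrite D0.
pose g (B : {set D}) := c (odflt x0 [pick x in B]).
apply: leq_trans (leq_imset_card g _).
apply/subset_leq_card/fintype.subsetP => _ /imsetP [x _ ->]; apply/imsetP.
exists (porbit s x); first exact: imset_f.
rewrite /g; case: pickP => [y /(porbit_invariant cs) //|/(_ x)].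
by rewrite porbit_id.
Qed.

Lemma card_porbits_closed s (A : {set D}) : (forall x, x \in A -> s x \in A) ->
  #|porbits s| = #|[set porbit s x | x in A]| + #|[set porbit s x | x in ~: A]|.
Proof.
move=> sA; rewrite -cardsUI.
rewrite (_ : _ :&: _ = finset.set0) ?cards0 ?addn0; last first.
  apply/setP => B; rewrite !inE; apply/negP => /andP [/imsetP [x xA ->]].
  move=> /imsetP [y yA] /eqP; rewrite eq_sym eq_porbit_mem => /porbitP [i yE].
  move: yA; rewrite inE yE permX; case/negP.
  by elim: i {yE} => //= i; apply: sA.
apply: eq_card => B; rewrite !inE.
apply/imsetP/orP => [[x _ ->]|[] /imsetP [x _ ->]]; try by exists x.
by case: (boolP (x \in A)) => xA; [left|right]; apply: imset_f; rewrite ?inE.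
Qed.

End Orbits.

Lemma porbit_inj (D D' : finType) (h : D' -> D) (s : {perm D})
    (s' : {perm D'}) x : injective h -> (forall x, h (s' x) = s (h x)) ->
  porbit s (h x) = h @: porbit s' x.
Proof.
move=> hI hs.
have hsi i y : h ((s' ^+ i)%g y) = (s ^+ i)%g (h y).
  by rewrite !permX; elim: i => //= i <-; rewrite hs.
apply/setP => y; apply/porbitP/imsetP => [[i ->]|[z /porbitP [i ->] ->]].
  by exists ((s' ^+ i)%g x); rewrite ?mem_porbit.
by exists i.
Qed.

Lemma card_porbits_inj (D D' : finType) (h : D' -> D) (s : {perm D})
    (s' : {perm D'}) : injective h -> (forall x, h (s' x) = s (h x)) ->
  #|[set porbit s (h x) | x in D']| = #|porbits s'|.
Proof.
move=> hI hs.
have -> : [set porbit s (h x) | x in D'] = [set h @: (B : {set D'}) | B in porbits s'].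
  by rewrite /porbits -imset_comp; apply: eq_imset => x /=; apply: porbit_inj.
by rewrite card_imset //; apply: imset_inj.
Qed.

(** * Planar maps as pairs of permutations *)

Section Planar.

(** A colouring that is constant on edges and faces is constant on connected
    components, and the largest number of colours is the number c of components.
    So for a fixed-point-free involution e the condition says
    [V - #|D| / 2 + F >= 2 c]: every component is a sphere.  Quantifying over
    colourings avoids counting components; surgery only has to carry a
    colouring of the new map back to one of the old map. *)
Definition planar (D : finType) (e f : {perm D}) : Prop :=
  forall (T : finType) (c : D -> T),
    (forall x, c (e x) = c x) -> (forall x, c (f x) = c x) ->
    4 * #|[set c x | x in D]| + #|D| <=
      2 * (#|porbits f| + #|porbits (e * f)%g|).

Variable D : finType.
Implicit Types (e f : {perm D}) (d g x y p q : D).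

Definition merge_colour (T : eqType) (a b : T) (c : D -> T) x :=
  if c x == a then b else c x.

(** When a surgery may disconnect a component, the two sides get a common colour. *)
Lemma card_merge_colour (T : finType) (c : D -> T) a b :
  #|[set c x | x in D]| <= #|[set merge_colour a b c x | x in D]|.+1.
Proof.
rewrite (cardsD1 a) -add1n; apply: leq_add; first by case: (a \in _).
apply/subset_leq_card/fintype.subsetP => z /finset.setD1P [za /imsetP [x _ Ez]].
by apply/imsetP; exists x; rewrite // /merge_colour -Ez (negbTE za).
Qed.

(** Cutting a face along a chord from p to q adds a face.  Either p and q are at
    the same vertex, which is cut in two while the component may fall apart, or
    their vertices are merged and the component stays connected. *)
Lemma planar_split e f p q : planar e f -> p != q -> p \in porbit f q ->
  planar e (f * tperm p q).
Proof.
move=> plan pq fpq T c ce cf.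
have F1 := card_porbits_split pq fpq.
have cfE x : c (tperm p q (f x)) = c x by rewrite -permM cf.
have [vpq | vpq] := boolP (p \in porbit (e * f)%g q).
  have V1 := card_porbits_split pq vpq; rewrite mulgA V1 F1.
  have := plan T (merge_colour (c p) (c q) c).
  have mt z : merge_colour (c p) (c q) c (tperm p q z) = merge_colour (c p) (c q) c z.
    rewrite /merge_colour; case: tpermP => // ->; rewrite eqxx; case: eqP => // ->.
  have H1 x : merge_colour (c p) (c q) c (e x) = merge_colour (c p) (c q) c x.
    by rewrite /merge_colour ce.
  have H2 x : merge_colour (c p) (c q) c (f x) = merge_colour (c p) (c q) c x.
    by rewrite -mt /merge_colour cfE.
  move=> /(_ H1 H2); have := card_merge_colour c (c p) (c q).
  lia.
have [V1 vpq'] := card_porbits_merge vpq; rewrite mulgA F1.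
have cpq : c p = c q.
  apply: (porbit_invariant _ vpq') => x.
  by rewrite -mulgA permM cf ce.
have H2 x : c (f x) = c x.
  by rewrite -[RHS]cfE; case: tpermP => // ->.
by apply: leq_trans (plan T c ce H2) _; rewrite -V1 addnS addSn.
Qed.

(** The edges of d and g are unglued; then d is glued to g and the two free sides
    to each other.  When d ends where g begins, or g where d begins, and the labels
    are inverse, this is folding. *)
Definition rezip e d g : {perm D} := (e * tperm (e d) g * tperm d (e g))%g.

Section Zip.
Variables (e : {perm D}) (d g : D).
Hypotheses (eK : involutive e) (e1 : forall x, e x != x).
Hypotheses (dg : d != g) (xg : e d != g).

Let eI : injective e := @perm_inj _ e.

Let neq : (((d == g) = false) * ((g == d) = false) *
           ((e d == g) = false) * ((g == e d) = false) *
           ((d == e g) = false) * ((e g == d) = false) *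
           ((d == e d) = false) * ((e d == d) = false) *
           ((g == e g) = false) * ((e g == g) = false) *
           ((e d == e g) = false) * ((e g == e d) = false))%type.
Proof.
have dy : d != e g by apply: contraNneq xg => ->; rewrite eK.
have xy : e d != e g by rewrite (inj_eq eI).
have [ed eg] := (e1 d, e1 g).
by do !split; apply/negbTE; rewrite // eq_sym.
Qed.

Let zneq z : z != d -> z != g -> z != e d -> z != e g ->
  ((e z == e d) = false) * ((e z == g) = false) *
  ((e z == d) = false) * ((e z == e g) = false).
Proof.
move=> zd zg zx zy; rewrite !(inj_eq eI) (can2_eq eK eK) (can2_eq eK eK z d).
by rewrite !(negbTE zd, negbTE zg, negbTE zx, negbTE zy).
Qed.

Lemma rezipE z : rezip e d g z =
    if z == d then g else if z == g then d else
    if z == e d then e g else if z == e g then e d else e z.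
Proof.
rewrite !permM !permE /=.
have [->|zd] := eqVneq z d; first by rewrite !(neq, eqxx).
have [->|zg] := eqVneq z g; first by rewrite !(neq, eqxx).
have [->|zx] := eqVneq z (e d); first by rewrite eK !(neq, eqxx).
have [->|zy] := eqVneq z (e g); first by rewrite eK !(neq, eqxx).
by rewrite !(zneq zd zg zx zy).
Qed.

Lemma rezip_involutive : involutive (rezip e d g).
Proof.
move=> z; rewrite [rezip _ _ _ z]rezipE.
have [->|zd] := eqVneq z d; first by rewrite rezipE !(neq, eqxx).
have [->|zg] := eqVneq z g; first by rewrite rezipE !(neq, eqxx).
have [->|zx] := eqVneq z (e d); first by rewrite rezipE !(neq, eqxx).
have [->|zy] := eqVneq z (e g); first by rewrite rezipE !(neq, eqxx).
by rewrite rezipE !(zneq zd zg zx zy) eK.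
Qed.

(** The number of faces does not change.  The first transposition splits a vertex,
    by hypothesis; the second one either merges two vertices, in which case all
    four darts keep one colour, or splits again, which pays for a component that
    may have been cut off. *)
Lemma planar_rezip f : planar e f -> f (e d) \in porbit (e * f)%g (f g) ->
  planar (rezip e d g) f.
Proof.
move=> plan vxg T c ce cf.
have Ev : (rezip e d g * f = e * f * tperm (f (e d)) (f g) * tperm (f d) (f (e g)))%g.
  by rewrite -!tpermJ !conjgE /rezip !mulgA !mulgK.
have fx : f (e d) != f g by rewrite (inj_eq perm_inj).
have V1 := card_porbits_split fx vxg.
have cxy : c (e d) = c (e g) by rewrite -ce rezipE !(neq, eqxx).
have cdg : c d = c g by rewrite -ce rezipE !(neq, eqxx).
have ceE z : z != d -> z != g -> z != e d -> z != e g -> c (e z) = c z.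
  move=> zd zg zx zy.
  by rewrite -[RHS]ce rezipE (negbTE zd) (negbTE zg) (negbTE zx) (negbTE zy).
rewrite Ev; set v1 := (e * f * _)%g in V1 *.
have [vdy | vdy] := boolP (f d \in porbit v1 (f (e g))).
  have V2 : #|porbits (v1 * tperm (f d) (f (e g)))%g| = #|porbits v1|.+1.
    by apply: card_porbits_split vdy; rewrite (inj_eq perm_inj) neq.
  rewrite V2 V1; set m := merge_colour (c (e d)) (c d) c.
  have me z : m (e z) = m z.
    rewrite /m /merge_colour.
    have [->|zd] := eqVneq z d; first by rewrite eqxx if_same.
    have [->|zg] := eqVneq z g; first by rewrite -cxy eqxx -cdg if_same.
    have [->|zx] := eqVneq z (e d); first by rewrite eK eqxx if_same.
    have [->|zy] := eqVneq z (e g); first by rewrite eK -cxy eqxx -cdg if_same.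
    by rewrite ceE.
  have mf z : m (f z) = m z by rewrite /m /merge_colour cf.
  have := plan T m me mf; have := card_merge_colour c (c (e d)) (c d).
  rewrite -/m; lia.
have [V2 vdy'] := card_porbits_merge vdy.
have cdy : c d = c (e g).
  rewrite -[LHS]cf -[RHS]cf; apply: (porbit_invariant _ vdy') => z.
  by rewrite -Ev permM cf ce.
have ce' z : c (e z) = c z.
  have [->|zd] := eqVneq z d; first by rewrite cxy cdy.
  have [->|zg] := eqVneq z g; first by rewrite -cdg -cdy.
  have [->|zx] := eqVneq z (e d); first by rewrite eK cxy cdy.
  have [->|zy] := eqVneq z (e g); first by rewrite eK -cdy cdg.
  exact: ceE.
apply: leq_trans (plan T c ce' cf) _; move: V1; rewrite -V2 => /eqP.
by rewrite eqSS => /eqP ->.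
Qed.

End Zip.

Section Restrict.
Variables (e f : {perm D}) (A : {set D}).
Hypotheses (eA : forall x, (e x \in A) = (x \in A)).
Hypotheses (fA : forall x, (f x \in A) = (x \in A)).

Let sub_perm_subproof (s : {perm D}) (sA : forall x, (s x \in A) = (x \in A)) :
  injective (fun u : {x | x \in A} =>
    Sub (s (val u)) (etrans (sA (val u)) (valP u)) : {x | x \in A}).
Proof. by move=> u v /(congr1 val) /= /perm_inj /val_inj. Qed.

Let restrict_arith k D0 a j fa fj va vj :
  4 * k.+1 + D0 <= 2 * (fa + fj + (va + vj)) -> 2 * (fj + vj) <= j + 4 ->
  a + j = D0 -> 4 * k + a <= 2 * (fa + va).
Proof. lia. Qed.

(** A union of components can be thrown away if it has Euler characteristic at
    most 2: at least one component is lost with it. *)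
Lemma planar_restrict : planar e f -> A != finset.setT ->
  2 * (#|[set porbit f x | x in ~: A]| + #|[set porbit (e * f)%g x | x in ~: A]|)
    <= #|~: A| + 4 ->
  exists (D' : finType) (h : D' -> D) (e' f' : {perm D'}),
    [/\ injective h, forall x, (x \in A) <-> (exists u, h u = x), #|D'| < #|D|,
        planar e' f' &
        (forall u, h (e' u) = e (h u)) /\ (forall u, h (f' u) = f (h u))].
Proof.
move=> plan AT cA.
pose e' := perm (@sub_perm_subproof e eA); pose f' := perm (@sub_perm_subproof f fA).
have he u : val (e' u) = e (val u) by rewrite permE.
have hf u : val (f' u) = f (val u) by rewrite permE.
have cD : #|{: {x | x \in A}}| = #|A| by rewrite card_sig.
have AD := cardsC A.
have A0 : 0 < #|~: A|.
  by rewrite card_gt0; apply: contraNneq AT => E; rewrite -[A]finset.setCK E finset.setC0.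
have orb (s : {perm D}) (s' : {perm {x | x \in A}}) : (forall u, val (s' u) = s (val u)) ->
    #|[set porbit s x | x in A]| = #|porbits s'|.
  move=> hs; rewrite -(card_porbits_inj val_inj hs); apply: eq_card => B.
  apply/imsetP/imsetP => [[x xA ->]|[u _ ->]]; last by exists (val u); rewrite ?(valP u).
  by exists (Sub x xA : {x | x \in A}).
exists {x | x \in A}, val, e', f'; split=> //.
- exact: val_inj.
- by move=> x; split=> [xA|[u <-]]; [exists (Sub x xA) | exact: valP].
- by rewrite cD; lia.
move=> T c ce cf.
(* The removed part gets a colour of its own, so it takes away a component. *)
pose c' x := omap c (insub x : option {x | x \in A}).
have c'V u : c' (val u) = Some (c u) by rewrite /c' valK.
have c'N x : x \notin A -> c' x = None by move=> xA; rewrite /c' insubN.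
have c's (s : {perm D}) (s' : {perm {x | x \in A}}) : (forall u, val (s' u) = s (val u)) ->
    (forall u, c (s' u) = c u) -> (forall x, (s x \in A) = (x \in A)) -> forall x, c' (s x) = c' x.
  move=> hs cs sA x; case: (boolP (x \in A)) => xA; last by rewrite !c'N ?sA.
  by rewrite -[x]/(val (Sub x xA : {x | x \in A})) -hs !c'V cs.
have := plan _ c' (c's e e' he ce eA) (c's f f' hf cf fA).
have -> : #|[set c' x | x in D]| = #|[set c x | x in {: {x | x \in A}}]|.+1.
  rewrite (cardsD1 None) -add1n; congr (_ + _).
    have /finset.set0Pn [x] : ~: A != finset.set0 by rewrite -card_gt0.
    rewrite inE => xA; have -> // : None \in [set c' x | x in D].
    by apply/imsetP; exists x; rewrite ?c'N.
  rewrite -[RHS](card_imset _ (@Some_inj _)); apply: eq_card => -[t|]; rewrite !inE /=; last first.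
    by apply/esym/negbTE/negP => /imsetP [].
  apply/imsetP/imsetP => [[x _ Ex]|[_ /imsetP [u _ ->] ->]]; last by exists (val u); rewrite ?c'V.
  case: (boolP (x \in A)) => xA; last by rewrite c'N in Ex.
  move: Ex; rewrite -[x]/(val (Sub x xA : {x | x \in A})) c'V => -[->].
  by exists (c (Sub x xA)); rewrite ?imset_f.
have fA' x : x \in A -> f x \in A by rewrite fA.
have vA x : x \in A -> (e * f)%g x \in A by rewrite permM fA eA.
rewrite (card_porbits_closed fA') (card_porbits_closed vA).
rewrite (orb f f' hf) (orb (e * f)%g (e' * f')%g); last first.
  by move=> u; rewrite !permM hf he.
rewrite cD => H; apply: restrict_arith H cA AD.
Qed.

End Restrict.
End Planar.

Section Sum.
Variables D1 D2 : finType.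

Let sum_perm_subproof (s1 : {perm D1}) (s2 : {perm D2}) :
  injective (fun x : D1 + D2 => match x with inl y => inl (s1 y) | inr y => inr (s2 y) end).
Proof. by move=> [x|x] [y|y] // [] /perm_inj ->. Qed.

Definition sum_perm s1 s2 : {perm (D1 + D2)%type} := perm (@sum_perm_subproof s1 s2).

Lemma sum_permE s1 s2 :
  (forall x, sum_perm s1 s2 (inl x) = inl (s1 x)) * (forall x, sum_perm s1 s2 (inr x) = inr (s2 x)).
Proof. by split=> x; rewrite permE. Qed.

Lemma sum_permM s1 s2 t1 t2 :
  (sum_perm s1 s2 * sum_perm t1 t2)%g = sum_perm (s1 * t1)%g (s2 * t2)%g.
Proof. by apply/permP => -[x|x]; rewrite permM !permE /= ?permE ?permM. Qed.

Lemma sum_perm_disjoint s1 s2 x y : inl x \notin porbit (sum_perm s1 s2) (inr y).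
Proof.
apply/negP => H; suff : true = false by [].
apply: (porbit_invariant (c := fun z => if z is inl _ then true else false) _ H).
by move=> [z|z]; rewrite permE.
Qed.

Lemma card_porbits_sum s1 s2 :
  #|porbits (sum_perm s1 s2)| = #|porbits s1| + #|porbits s2|.
Proof.
have sA x : x \in inl @: [set: D1] -> sum_perm s1 s2 x \in inl @: [set: D1].
  by move=> /imsetP [y _ ->]; rewrite permE imset_f ?inE.
rewrite (card_porbits_closed sA).
have <- := @card_porbits_inj _ _ inl (sum_perm s1 s2) s1 (@inl_inj D1 D2).
  have <- := @card_porbits_inj _ _ inr (sum_perm s1 s2) s2 (@inr_inj D1 D2).
    congr (_ + _); apply: eq_card => B; apply/imsetP/imsetP => -[x].
    - by case/imsetP => y _ -> ->; exists y.
    - by move=> _ ->; exists (inl x); rewrite ?imset_f ?inE.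
    - case: x => [x|x]; last by move=> _ ->; exists x.
      by rewrite inE imset_f ?inE.
    - move=> _ ->; exists (inr x) => //; rewrite inE.
      by apply/negP => /imsetP [].
  by move=> x; rewrite permE.
by move=> x; rewrite permE.
Qed.

Let join_arith k k1 k2 d1 d2 f1 f2 v1 v2 f v :
  4 * k1 + d1 <= 2 * (f1 + v1) -> 4 * k2 + d2 <= 2 * (f2 + v2) -> k.+1 <= k1 + k2 ->
  f.+1 = f1 + f2 -> v.+1 = v1 + v2 -> 4 * k + (d1 + d2) <= 2 * (f + v).
Proof. lia. Qed.

(** Two spheres touching at a point, the faces at that point being merged. *)
Lemma planar_join e1 f1 e2 f2 o1 o2 : planar e1 f1 -> planar e2 f2 ->
  planar (sum_perm e1 e2) (sum_perm f1 f2 * tperm (inl o1) (inr o2)).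
Proof.
move=> plan1 plan2 T c ce cf'.
have [F1 fm] := card_porbits_merge (sum_perm_disjoint f1 f2 o1 o2).
have [V1 _] := card_porbits_merge (sum_perm_disjoint (e1 * f1)%g (e2 * f2)%g o1 o2).
have co : c (inl o1) = c (inr o2) by exact: porbit_invariant fm.
have cf x : c (sum_perm f1 f2 x) = c x.
  by rewrite -[RHS]cf' permM; case: tpermP => // ->.
have H1 := plan1 T (c \o inl); have H2 := plan2 T (c \o inr).
have {}H1 : 4 * #|[set (c \o inl) x | x in D1]| + #|D1| <= 2 * (#|porbits f1| + #|porbits (e1 * f1)%g|).
  apply: H1 => x /=; first by rewrite -[RHS]ce permE.
  by rewrite -[RHS]cf permE.
have {}H2 : 4 * #|[set (c \o inr) x | x in D2]| + #|D2| <= 2 * (#|porbits f2| + #|porbits (e2 * f2)%g|).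
  apply: H2 => x /=; first by rewrite -[RHS]ce permE.
  by rewrite -[RHS]cf permE.
have C : #|[set c x | x in {: D1 + D2}]|.+1 <=
    #|[set (c \o inl) x | x in D1]| + #|[set (c \o inr) x | x in D2]|.
  rewrite -cardsUI -addn1; apply: leq_add.
    apply/subset_leq_card/fintype.subsetP => _ /imsetP [[x|x] _ ->]; rewrite inE.
      by rewrite (imset_f (c \o inl)).
    by rewrite (imset_f (c \o inr)) ?orbT.
  rewrite card_gt0; apply/finset.set0Pn; exists (c (inl o1)).
  by rewrite inE (imset_f (c \o inl)) // co (imset_f (c \o inr)).
rewrite mulgA sum_permM card_sum; move: F1 V1; rewrite !card_porbits_sum => F1 V1.
exact: join_arith H1 H2 C F1 V1.
Qed.

End Sum.

(** * Inverses and cyclic shifts of words *)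

Section Words.
Variable X : choiceType.
Implicit Types (a b : letter X) (u v w : word X) (r : set (word X)).

Lemma linv_neq a : linv a != a.
Proof. by case: a => x b; apply/eqP => -[]; case: b. Qed.

Lemma winv_cat u v : winv (u ++ v) = winv v ++ winv u.
Proof. by rewrite /winv map_cat rev_cat. Qed.

Lemma winv_cons a u : winv (a :: u) = rcons (winv u) (linv a).
Proof. by rewrite /winv /= rev_cons. Qed.

Lemma winv_rcons a u : winv (rcons u a) = linv a :: winv u.
Proof. by rewrite /winv map_rcons rev_rcons. Qed.

Lemma size_winv u : size (winv u) = size u.
Proof. by rewrite size_rev size_map. Qed.

Lemma rot_rot_ex n m w : exists k, rot n (rot m w) = rot k w.
Proof.
have [nw|nw] := leqP n (size w); last by exists m; rewrite rot_oversize ?size_rot // ltnW.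
have [mw|mw] := leqP m (size w); last by exists n; rewrite (@rot_oversize _ m) // ltnW.
by rewrite rot_add_mod //; case: ifP => _; eexists.
Qed.

Lemma winv_rot n w : exists k, winv (rot n w) = rot k (winv w).
Proof.
have [nw|nw] := leqP n (size w); last by exists 0; rewrite rot0 rot_oversize // ltnW.
exists (size (winv (drop n w))).
have E : winv w = winv (drop n w) ++ winv (take n w) by rewrite -winv_cat cat_take_drop.
by rewrite /rot winv_cat E drop_size_cat // take_size_cat.
Qed.

Lemma symm_closure_mem r w : r w -> symm_closure r w.
Proof. by move=> rw; exists w => //; exists 0; rewrite rot0; left. Qed.

Lemma symm_closure_rot r n w : symm_closure r w -> symm_closure r (rot n w).
Proof.
move=> [v rv [m [->|->]]]; exists v => //.
  by have [k ->] := rot_rot_ex n m v; exists k; left.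
by have [k ->] := rot_rot_ex n m (winv v); exists k; right.
Qed.

Lemma symm_closure_inv r w : symm_closure r w -> symm_closure r (winv w).
Proof.
move=> [v rv [m [->|->]]]; exists v => //.
  by have [k ->] := winv_rot m v; exists k; right.
by have [k ->] := winv_rot m (winv v); rewrite winvK; exists k; left.
Qed.

End Words.

(** * Words read along faces *)

Section FaceWord.
Variable X : choiceType.

Definition face_word (D : finType) (f : {perm D}) (l : D -> letter X) x : word X :=
  map l (traject f x #|porbit f x|).

Lemma size_face_word (D : finType) (f : {perm D}) (l : D -> letter X) x :
  size (face_word f l x) = #|porbit f x|.
Proof. by rewrite size_map size_traject. Qed.

(** A face keeps its word under every surgery that leaves its cycle alone; the map
    h accounts for changes of the set of darts. *)
Lemma face_word_transport (D D' : finType) (h : D' -> D) (f : {perm D})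
    (f' : {perm D'}) (l : D -> letter X) y : injective h ->
  (forall z, z \in porbit f' y -> f (h z) = h (f' z)) ->
  face_word f l (h y) = face_word f' (l \o h) y.
Proof.
move=> hI hf; rewrite /face_word map_comp; congr map.
set p := traject f' y _.
have Up : uniq (map h p) by rewrite map_inj_uniq // uniq_traject_porbit.
have Cp : fcycle f (map h p).
  apply: (@homo_cycle_in _ _ (mem p) h (frel f')); last exact: fcycle_traject_porbit.
    by move=> a b ap bp /= /eqP <-; rewrite hf // porbit_traject.
  exact/allP.
have := card_porbit_neq0 f' y; move: Up Cp; rewrite /p.
by case: #|_| => // n Up Cp _; rewrite (traject_porbit_fcycle Up Cp).
Qed.

Lemma face_word_fcycle (D : finType) (f : {perm D}) (l : D -> letter X) x p :
  uniq (x :: p) -> fcycle f (x :: p) -> face_word f l x = map l (x :: p).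
Proof. by move=> Up Cp; rewrite /face_word (traject_porbit_fcycle Up Cp). Qed.

Lemma porbit_fcycle (D : finType) (f : {perm D}) (x : D) p :
  uniq (x :: p) -> fcycle f (x :: p) -> porbit f x =i x :: p.
Proof. by move=> Up Cp z; rewrite porbit_traject (traject_porbit_fcycle Up Cp). Qed.

Lemma face_word_step (D : finType) (f : {perm D}) (l : D -> letter X) x :
  face_word f l (f x) = rot 1 (face_word f l x).
Proof.
have E := porbit_stepE f x.
have := iter_porbit f x; have := card_porbit_neq0 f x.
rewrite /face_word E -map_rot; case: #|_| => // n _ nx.
by rewrite trajectSr -iterSr nx trajectS rot1_cons.
Qed.

Lemma face_word_iter (D : finType) (f : {perm D}) (l : D -> letter X) x y :
  y \in porbit f x -> exists n, face_word f l y = rot n (face_word f l x).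
Proof.
move=> /porbitP [i ->]; rewrite permX.
elim: i => [|i [n IH]]; first by exists 0; rewrite rot0.
by rewrite iterS face_word_step IH; have [k ->] := rot_rot_ex 1 n (face_word f l x); exists k.
Qed.

Lemma traject_permV (D : finType) (f : {perm D}) y n : iter n f y = y ->
  rev (traject f (f y) n) = traject f^-1%g y n.
Proof.
move=> ny; apply: (@eq_from_nth _ y); rewrite size_rev !size_traject // => i i_n.
rewrite nth_rev size_traject //.
rewrite (set_nth_default (f y)) ?size_traject; last by lia.
rewrite nth_traject ?nth_traject //; last by lia.
rewrite -iterSr -subSn // subSS.
have -> : iter i f^-1%g y = iter i f^-1%g (iter i f (iter (n - i) f y)).
  by rewrite -iterD subnKC ?ny // ltnW.
have K k z : iter k f^-1%g (iter k f z) = z.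
  by elim: k => // k IH; rewrite iterSr iterS permK.
by rewrite K.
Qed.

(** The inverse word is read by walking backwards. *)
Lemma face_word_winv (D : finType) (f : {perm D}) (l : D -> letter X) y :
  winv (face_word f l (f y)) = map (fun z => linv (l z)) (traject f^-1%g y #|porbit f y|).
Proof.
have E := porbit_stepE f y.
rewrite /winv /face_word -map_comp -map_rev E.
by rewrite traject_permV // iter_porbit.
Qed.

End FaceWord.

(** * Diagrams and their surgery *)

Section Diagram.
Variables (X : choiceType) (r : set (word X)).

Definition is_labelling (D : finType) (e : {perm D}) (l : D -> letter X) :=
  forall x, l (e x) = linv (l x).

Record diagram (D : finType) (e f : {perm D}) (l : D -> letter X) (o : D) : Prop :=
  Diagram {
    diagram_planar : planar e f;
    diagram_edge : involutive e;
    diagram_label : is_labelling e l;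
    diagram_face : forall x, x \notin porbit f o -> symm_closure r (face_word f l x)
  }.

Definition bounds (w : word X) : Prop :=
  exists (D : finType) (e f : {perm D}) (l : D -> letter X) (o : D),
    diagram e f l o /\ face_word f l o = w.

(** The outer face of a map has at least one dart, so the empty word needs a clause
    of its own. *)
Definition bounds_or_nil (w : word X) : Prop := w = [::] \/ bounds w.

Lemma labelling_neq (D : finType) (e : {perm D}) l : is_labelling e l ->
  forall x, e x != x.
Proof.
by move=> le x; apply: contraTneq isT => ex; have := linv_neq (l x); rewrite -le ex eqxx.
Qed.

Lemma rezip_labelling (D : finType) (e : {perm D}) (l : D -> letter X) d g :
  involutive e -> is_labelling e l -> d != g -> e d != g -> l g = linv (l d) ->
  is_labelling (rezip e d g) l.
Proof.
move=> eK le dg xg lg x; have e1 := labelling_neq le.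
rewrite (rezipE eK e1 dg xg).
have [->//|_] := eqVneq x d.
have [->|_] := eqVneq x g; first by rewrite lg linvK.
have [->|_] := eqVneq x (e d); first by rewrite !le lg linvK.
by have [->|_] := eqVneq x (e g); rewrite ?le // lg linvK.
Qed.

Lemma bounds_rot n w : bounds w -> bounds (rot n w).
Proof.
move=> [D [e [f [l [o [dg <-]]]]]].
have H m : face_word f l (iter m f o) = rot m (face_word f l o) \/ size (face_word f l o) <= m.
  elim: m => [|m IH]; first by left; rewrite rot0.
  have [sm|ms] := leqP (size (face_word f l o)) m.+1; first by right.
  left; case: IH => [IH|]; last by lia.
  rewrite iterS face_word_step IH rot_add_mod ?add1n ?(ltnW ms) //; lia.
case: (H n) => [E|sn]; last by rewrite rot_oversize //; exists D, e, f, l, o.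
exists D, e, f, l, (iter n f o); split=> //; case: dg => pl eK le fa; split=> //.
move=> x; rewrite -permX -eq_porbit_mem porbit_perm eq_porbit_mem; exact: fa.
Qed.

(** Two cells glued along their whole boundary: the face [(_, true)] reads R and
    the face [(_, false)] reads the inverse of R. *)
Lemma bounds_relator R : R <> [::] -> symm_closure r R -> bounds R.
Proof.
case: R => // a0 R' _; set R := a0 :: R' => rR; pose n := (size R').
pose D : finType := ('I_n.+1 * bool)%type.
pose fo := perm (@ordS_inj n.+1).
pose ff (x : D) := (if x.2 then fo x.1 else fo^-1%g x.1, x.2).
have ffI : injective ff.
  by move=> [i b] [j c] [] /= E bc; rewrite bc in E *; case: c bc E => _ /perm_inj ->.
have eeI : injective (fun x : D => (x.1, ~~ x.2)) by move=> [i b] [j c] [-> /negb_inj ->].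
pose f := perm ffI; pose e := perm eeI.
pose l (x : D) := if x.2 then nth a0 R x.1 else linv (nth a0 R x.1).
have eK : involutive e by move=> [i b]; rewrite !permE /= negbK.
have le : is_labelling e l.
  by move=> [i b]; rewrite permE /l /=; case: b; rewrite //= linvK.
have foi k : k <= n -> val (iter k fo ord0) = k.
  elim: k => // k IH kn; rewrite iterS permE /= IH ?modn_small //; lia.
have Et : traject fo ord0 n.+1 = enum 'I_n.+1.
  apply: (inj_map val_inj); rewrite val_enum_ord; apply: (@eq_from_nth _ 0).
    by rewrite size_map size_traject size_iota.
  move=> i; rewrite size_map size_traject => i_n.
  by rewrite (nth_map ord0) ?size_traject // nth_traject // nth_iota // foi.
have nfo : fo (iter n fo ord0) = ord0.
  by apply: val_inj; rewrite permE /= foi // modnn.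
have Cy : fcycle fo (traject fo ord0 n.+1).
  by rewrite /= rcons_path fpath_traject last_traject /= nfo.
have Uq : uniq (traject fo ord0 n.+1) by rewrite Et enum_uniq.
pose o : D := (ord0, true); pose l1 i := nth a0 R (val (i : 'I_n.+1)).
have Wo : face_word f l o = R.
  rewrite (@face_word_transport _ _ _ (fun i => (i, true)) f fo) => [|i j [] //|i _].
    rewrite /face_word (traject_porbit_fcycle Uq Cy) -[_ :: _]/(traject fo ord0 n.+1) Et.
    rewrite (@eq_map _ _ _ l1) // (map_comp (nth a0 R) val).
    by rewrite val_enum_ord -[RHS](mkseq_nth a0).
  by rewrite permE.
have Wo' : face_word f l (ord_max, false) = winv R.
  rewrite (@face_word_transport _ _ _ (fun i => (i, false)) f fo^-1%g) => [|i j [] //|i _].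
    have fm : fo ord_max = ord0 by apply: val_inj; rewrite permE /= modnn.
    rewrite -Wo -[o]/((fun i => (i, true)) ord0).
    rewrite (@face_word_transport _ _ _ (fun i => (i, true)) f fo) => [|i j [] //|i _].
      by rewrite -fm face_word_winv /face_word porbitV.
    by rewrite permE.
  by rewrite permE.
have fo0 i : exists2 k, k < n.+1 & i = iter k fo ord0.
  by apply/trajectP; rewrite Et mem_enum.
have O i : (i, true) \in porbit f o.
  have [k _ ->] := fo0 i; apply/porbitP; exists k; rewrite permX.
  by elim: k => //= k <-; rewrite [f _]permE.
have O0 i : (ord0, false) \in porbit f (i, false).
  have [k _ ->] := fo0 i; apply/porbitP; exists k; rewrite permX.
  by elim: k => // k IH; rewrite iterSr [f _]permE /ff /= permK.
have O' i : (i, false) \in porbit f (ord_max, false).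
  rewrite -eq_porbit_mem.
  have := O0 i; have := O0 ord_max; rewrite -!eq_porbit_mem => /eqP <- /eqP <-.
  exact: eqxx.
exists D, e, f, l, o; split=> //; split=> //.
- move=> T c ce cf.
  have c1 x : c x = c o.
    case: x => i [|]; first exact: (porbit_invariant cf (O i)).
    by rewrite -ce permE /=; apply: (porbit_invariant cf (O i)).
  have C1 : #|[set c x | x in D]| <= 1.
    rewrite -(cards1 (c o)); apply: subset_leq_card; apply/fintype.subsetP => _ /imsetP [x _ ->].
    by rewrite inE c1.
  have F2 : 2 <= #|porbits f|.
    apply: leq_trans (card_invariant (c := snd) _); last by move=> x; rewrite permE.
    rewrite -card_bool; apply/subset_leq_card/fintype.subsetP => b _.
    by apply/imsetP; exists (ord0, b).
  have V2 : n.+1 <= #|porbits (e * f)%g|.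
    pose k (x : D) := if x.2 then x.1 else fo x.1.
    apply: leq_trans (card_invariant (c := k) _).
      rewrite -[X in X <= _]card_ord; apply/subset_leq_card/fintype.subsetP => i _.
      by apply/imsetP; exists (i, true).
    by case=> i [|]; rewrite permM !permE /k /= ?permKV.
  rewrite card_prod card_bool card_ord.
  move: C1 F2 V2; clear; set A := #|_|; set B := #|_|; set C := #|_|; lia.
- move=> [i b] io; have {io}-> : b = false by case: b io => //; rewrite O.
  have [k ->] := face_word_iter l (O' i); apply: symm_closure_rot.
  by rewrite Wo'; apply: symm_closure_inv.
Qed.

(** A single edge in a sphere, whose only face runs along both sides. *)
Lemma bounds_spur a : bounds [:: a; linv a].
Proof.
pose s : {perm bool} := perm (can_inj negbK).
pose l b := if b then a else linv a.
have C : fcycle s [:: true; false] by rewrite /= !permE.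
have E := @porbit_fcycle _ s true [:: false] isT C.
exists bool, s, s, l, true; split; last by rewrite (face_word_fcycle l _ C).
split.
- move=> T c cs _; rewrite (_ : (s * s)%g = 1%g); last first.
    by apply/permP => b; rewrite permM !permE negbK.
  have ct b : c b = c true by case: b => //; rewrite -[RHS]cs permE.
  have : #|[set c b | b in {: bool}]| <= 1.
    rewrite -(cards1 (c true)); apply: subset_leq_card; apply/fintype.subsetP => _ /imsetP [b _ ->].
    by rewrite inE ct.
  have : 2 <= #|porbits (1 : {perm bool})%g|.
    rewrite -card_bool; apply: leq_trans (card_invariant (c := id) _).
      by rewrite card_imset.
    by move=> b; rewrite perm1.
  have : 1 <= #|porbits s|.
    by rewrite card_gt0; apply/set0Pn; exists (porbit s true); apply: imset_f.
  by rewrite card_bool; set A := #|_|; set B := #|_|; set C' := #|_|; lia.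
- by move=> b; rewrite !permE negbK.
- by move=> b; rewrite permE /l; case: b; rewrite //= linvK.
- by move=> x; rewrite E; case: x.
Qed.

(** The transposition diverts a path only where the path enters p or q. *)
Lemma fpath_skip (D D' : finType) (h : D' -> D) (f : {perm D}) (f' : {perm D'}) p q x s :
  (forall z, f (h z) = tperm p q (h (f' z))) -> fpath f' x s ->
  p \notin map h s -> q \notin map h s -> fpath f (h x) (map h s).
Proof.
move=> fE; elim: s x => //= y s IH x /andP [/eqP xy ys].
rewrite !inE !negb_or => /andP [py ps] /andP [qy qs].
by rewrite fE xy tpermD // eqxx IH.
Qed.

Lemma traject_porbit_cons (D : finType) (f : {perm D}) x :
  exists p, traject f x #|porbit f x| = x :: p.
Proof. by have := card_porbit_neq0 f x; case: #|_| => // n _; exists (traject f (f x) n). Qed.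

(** Join the two maps at the base points of their outer faces. *)
Lemma bounds_cat u v : bounds u -> bounds v -> bounds (u ++ v).
Proof.
move=> [D1 [e1 [f1 [l1 [o1 [[pl1 eK1 le1 fa1] <-]]]]]].
move=> [D2 [e2 [f2 [l2 [o2 [[pl2 eK2 le2 fa2] <-]]]]]].
pose D : finType := (D1 + D2)%type.
pose f : {perm D} := (sum_perm f1 f2 * tperm (inl o1) (inr o2))%g.
pose l (x : D) := match x with inl y => l1 y | inr y => l2 y end.
have f1E z : f (inl z) = tperm (inl o1) (inr o2) (inl (f1 z)) by rewrite permM sum_permE.
have f2E z : f (inr z) = tperm (inl o1) (inr o2) (inr (f2 z)) by rewrite permM sum_permE.
have [[p1 E1] [p2 E2]] := (traject_porbit_cons f1 o1, traject_porbit_cons f2 o2).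
have := fcycle_traject_porbit f1 o1; have := uniq_traject_porbit f1 o1.
have := fcycle_traject_porbit f2 o2; have := uniq_traject_porbit f2 o2.
rewrite E1 E2 /= !rcons_path => /andP [o2p U2] /andP [P2 /eqP L2].
move=> /andP [o1p U1] /andP [P1 /eqP L1].
set p := map inl p1 ++ inr o2 :: map inr p2.
have nlr (A B : eqType) (x : A) (t : seq B) : (inl x : A + B) \notin map inr t.
  by apply/negP => /mapP [].
have nrl (A B : eqType) (x : A) (t : seq B) : (inr x : B + A) \notin map inl t.
  by apply/negP => /mapP [].
have pE : (inl o1 : D) :: p = map inl (o1 :: p1) ++ map inr (o2 :: p2) by [].
have Up : uniq ((inl o1 : D) :: p).
  rewrite pE cat_uniq !map_inj_uniq; try by move=> ? ? [].
  rewrite /= o1p U1 o2p U2 /= !andbT negb_or /=; apply/andP; split.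
    by rewrite inE /=; apply/negP => /mapP [].
  by apply/hasPn => _ /mapP [z _ ->]; rewrite inE; apply/negP => /mapP [].
have Cp : fcycle f ((inl o1 : D) :: p).
  rewrite /= rcons_path cat_path last_cat /= !last_map.
  have -> : fpath f (inl o1) (map inl p1).
    by apply: fpath_skip f1E P1 _ (nrl _ _ _ _); rewrite mem_map // => ? ? [].
  have -> : fpath f (inr o2) (map inr p2).
    by apply: fpath_skip f2E P2 (nlr _ _ _ _) _; rewrite mem_map // => ? ? [].
  by rewrite f1E f2E L1 L2 tpermL tpermR !eqxx.
exists D, (sum_perm e1 e2), f, l, (inl o1); split; last first.
  by rewrite (face_word_fcycle l Up Cp) pE /face_word E1 E2 map_cat -!map_comp.
split; first exact: planar_join.
- by move=> [x|x]; rewrite !sum_permE ?eK1 ?eK2.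
- by move=> [x|x]; rewrite sum_permE /= ?le1 ?le2.
move=> x; rewrite (porbit_fcycle Up Cp) pE mem_cat -E1 -E2.
case: x => x; rewrite mem_map; try by move=> ? ? [].
  rewrite (negbTE (nlr _ _ _ _)) orbF -porbit_traject => xo.
  rewrite (@face_word_transport _ _ _ inl f f1) => [|? ? [] //|z zx]; first exact: fa1.
  rewrite f1E tpermD //; apply/eqP => // -[zo].
  by have := porbit_step_notin xo zx; rewrite -zo porbit_id.
rewrite (negbTE (nrl _ _ _ _)) /= -porbit_traject => xo.
rewrite (@face_word_transport _ _ _ inr f f2) => [|? ? [] //|z zx]; first exact: fa2.
rewrite f2E tpermD //; apply/eqP => // -[zo].
by have := porbit_step_notin xo zx; rewrite -zo porbit_id.
Qed.

Lemma diagram_restrict (D : finType) (e f : {perm D}) (l : D -> letter X) o (A : {set D}) :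
  planar e f -> involutive e -> is_labelling e l ->
  (forall x, (e x \in A) = (x \in A)) -> (forall x, (f x \in A) = (x \in A)) ->
  A != [set: D]%SET -> o \in A ->
  2 * (#|[set porbit f x | x in ~: A]%SET| + #|[set porbit (e * f)%g x | x in ~: A]%SET|)
    <= #|~: A| + 4 ->
  (forall x, x \in A -> x \notin porbit f o -> symm_closure r (face_word f l x)) ->
  exists (D' : finType) (e' f' : {perm D'}) (l' : D' -> letter X) (o' : D'),
    [/\ #|D'| < #|D|, diagram e' f' l' o' & face_word f' l' o' = face_word f l o].
Proof.
move=> pl eK le eA fA AT oA cA fa.
have [D' [h [e' [f' [hI hA DD pl' [he hf]]]]]] := planar_restrict eA fA pl AT cA.
have /hA [o' ho'] := oA.
have fw u : face_word f l (h u) = face_word f' (l \o h) u.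
  by apply: face_word_transport.
exists D', e', f', (l \o h), o'; split=> //; last by rewrite -fw ho'.
split=> //.
- by move=> u; apply: hI; rewrite !he eK.
- by move=> u; rewrite /= he le.
move=> u uo; rewrite -fw; apply: fa; first by apply/hA; exists u.
by rewrite -ho' (porbit_inj _ hI hf) mem_imset.
Qed.

(** Cut the two darts off the outer face, which leaves a bigon; glue its sides to
    each other, so that it becomes a closed component; and remove it. *)
Lemma bounds_fold a u : u <> [::] -> bounds (a :: linv a :: u) -> bounds u.
Proof.
move=> u0 [D [e [f [l [d [[pl eK le fa] W]]]]]].
move: W; rewrite /face_word.
have := fcycle_traject_porbit f d; have := uniq_traject_porbit f d.
have := @porbit_traject _ f d; have [p ->] := traject_porbit_cons f d.
case: p => [|g [|h s]] //= Ed; first by move=> _ _ [_ _ /esym].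
move=> /and4P [dgs gs hs Us] /and3P [/eqP dg /eqP gh]; rewrite rcons_path => /andP [Ps /eqP Ls].
move=> [la lg lu].
have [d_g d_h ds] : [/\ d != g, d != h & d \notin s].
  by move: dgs; rewrite !inE !negb_or => /and3P [].
have [g_h gs'] : g != h /\ g \notin s by move: gs; rewrite inE negb_or => /andP [].
(* The cycle (d g h ...) of f becomes the two cycles (d g) and (h ...). *)
pose f1 := (f * tperm d h)%g.
have f1E z : f1 z = tperm d h (f z) by rewrite permM.
have f1d : f1 d = g by rewrite f1E dg tpermD // eq_sym.
have f1g : f1 g = d by rewrite f1E gh tpermR.
have pl1 : planar e f1.
  by apply: planar_split; rewrite // porbit_sym Ed !inE eqxx !orbT.
have U1 : uniq [:: d; g] by rewrite /= inE d_g.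
have C1 : fcycle f1 [:: d; g] by rewrite /= f1d f1g !eqxx.
have U2 : uniq (h :: s) by rewrite /= hs.
have C2 : fcycle f1 (h :: s).
  rewrite /= rcons_path /= f1E Ls tpermL eqxx andbT.
  by have := @fpath_skip _ _ id f1 f d h h s; rewrite map_id; apply.
have lgd : l g = linv (l d) by rewrite la.
have [e' [pl' eK' le' e'd]] : exists e' : {perm D},
    [/\ planar e' f1, involutive e', is_labelling e' l & e' d = g].
  have e1 := labelling_neq le.
  have [edg|edg] := eqVneq (e g) d; first by exists e; rewrite -edg eK.
  have g_d : g != d by rewrite eq_sym.
  exists (rezip e g d); split.
  - apply: planar_rezip => //; rewrite -permM f1d; exact: porbit_step.
  - exact: rezip_involutive.
  - by apply: rezip_labelling; rewrite // lgd linvK.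
  - by rewrite rezipE // (negbTE d_g) eqxx.
have e'g : e' g = d by rewrite -e'd eK'.
have inJ (s' : {perm D}) x : s' d = g -> s' g = d -> s' x \in ~: [set d; g]%SET = (x \in ~: [set d; g]%SET).
  by move=> sd sg; rewrite !inE -{1}sg -{2}sd !(inj_eq perm_inj) orbC.
have [||||||D' [e2 [f2 [l2 [o2 [_ dg2 W2]]]]]] :=
    @diagram_restrict D e' f1 l h (~: [set d; g])%SET pl' eK' le'.
- by move=> x; apply: inJ.
- by move=> x; apply: inJ.
- by apply/eqP => /setP /(_ d); rewrite !inE eqxx.
- by rewrite !inE negb_or eq_sym d_h eq_sym g_h.
- rewrite finset.setCK cards2 d_g.
  have : #|[set porbit f1 x | x in [set d; g]%SET]%SET| <= 1.
    rewrite -(cards1 (porbit f1 d)); apply: subset_leq_card; apply/fintype.subsetP => _ /imsetP [x xJ ->].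
    by rewrite inE eq_porbit_mem (porbit_fcycle U1 C1); move: xJ; rewrite !inE.
  have : #|[set porbit (e' * f1)%g x | x in [set d; g]%SET]%SET| <= 2.
    by apply: leq_trans (leq_imset_card _ _) _; rewrite cards2; case: (d != g).
  by lia.
- move=> x; rewrite (porbit_fcycle U2 C2) !inE !negb_or => /andP [xd xg] /andP [xh xs].
  have xo : x \notin porbit f d by rewrite Ed !inE (negbTE xd) (negbTE xg) (negbTE xh).
  rewrite (@face_word_transport _ _ _ id f1 f) => [|//|z zx]; first exact: fa.
  have := porbit_step_notin xo zx; rewrite Ed !inE !negb_or => /and4P [fd _ fh _].
  by rewrite f1E tpermD // eq_sym.
exists D', e2, f2, l2, o2; split=> //.
by rewrite W2 (face_word_fcycle l U2 C2).
Qed.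

Lemma bounds_or_nil_cat u v : bounds_or_nil u -> bounds_or_nil v -> bounds_or_nil (u ++ v).
Proof.
move=> [->//|fu] [->|fv]; first by rewrite cats0; right.
by right; apply: bounds_cat.
Qed.

Lemma bounds_or_nil_rot u v : bounds_or_nil (u ++ v) -> bounds_or_nil (v ++ u).
Proof.
move=> [/eqP|fuv]; first by case: u v => [|//] [|//] _; left.
by right; rewrite -(rot_size_cat u v); apply: bounds_rot.
Qed.

Lemma bounds_or_nil_insert v p q : bounds_or_nil v -> bounds_or_nil (p ++ q) -> bounds_or_nil (p ++ v ++ q).
Proof.
by move=> fv /bounds_or_nil_rot /(bounds_or_nil_cat fv); rewrite catA => /bounds_or_nil_rot.
Qed.

Lemma bounds_or_nil_cancel a p q : bounds_or_nil (p ++ [:: a; linv a] ++ q) -> bounds_or_nil (p ++ q).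
Proof.
move=> /bounds_or_nil_rot; rewrite -catA => -[//|] H; apply: bounds_or_nil_rot.
case E : (q ++ p) H => [|b u] H; first by left.
by right; apply: (bounds_fold (a := a)).
Qed.

Lemma bounds_or_nil_cancel_word R p q : bounds_or_nil (p ++ R ++ winv R ++ q) -> bounds_or_nil (p ++ q).
Proof.
elim/last_ind: R p => [//|R a IH] p; rewrite winv_rcons => H; apply: IH.
rewrite catA; apply: (@bounds_or_nil_cancel a); move: H.
by rewrite -cats1 -!catA.
Qed.

Hypothesis r_neq0 : forall R, r R -> R <> [::].

(** A relator is deleted by inserting its inverse next to it and folding. *)
Lemma bounds_or_nil_step u v : pres_step r u v -> bounds_or_nil u <-> bounds_or_nil v.
Proof.
case=> [_ _ [p q a]|p q R rR]; split.
- exact: bounds_or_nil_cancel.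
- by apply: bounds_or_nil_insert; right; apply: bounds_spur.
- move=> H; apply: (@bounds_or_nil_cancel_word R).
  rewrite catA; apply: bounds_or_nil_insert; last by rewrite -catA.
  right; apply: bounds_relator; last by apply/symm_closure_inv/symm_closure_mem.
  by move=> /(congr1 (@winv _)); rewrite winvK => /(r_neq0 rR).
- apply: bounds_or_nil_insert; right; apply: bounds_relator; first exact: r_neq0.
  exact: symm_closure_mem.
Qed.

Lemma bounds_trivial w : w <> [::] -> pres_eq r w [::] -> bounds w.
Proof.
move=> w0 /asboolP H; suff : bounds_or_nil w by case.
have : bounds_or_nil w <-> bounds_or_nil [::].
  elim: H => [u v /bounds_or_nil_step //|//|u v _ ->//|u v t _ -> _ ->//].
by move=> ->; left.
Qed.

(** If the faces on the two sides of an edge read inverse words from there, glue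
    them dart by dart.  The pair becomes a closed component that can be removed.
    The two faces are distinct, since a non-empty cyclically reduced word is not
    a cyclic shift of its own inverse: the reflection of the cycle would fix a
    letter or exchange two neighbours. *)
Lemma diagram_mirror (D : finType) (e f : {perm D}) (l : D -> letter X) (o d : D) :
  diagram e f l o -> (forall x, l (f x) <> linv (l x)) ->
  d \notin porbit f o -> e d \notin porbit f o ->
  face_word f l d = winv (face_word f l (f (e d))) ->
  exists (D' : finType) (e' f' : {perm D'}) (l' : D' -> letter X) (o' : D'),
    [/\ #|D'| < #|D|, diagram e' f' l' o' & face_word f' l' o' = face_word f l o].
Proof.
move=> [pl eK le fa] lred dO xO Ew.
pose n := #|porbit f d|.
have nE : #|porbit f (e d)| = n.
  by have := congr1 size Ew; rewrite size_winv !size_face_word porbit_stepE.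
pose a i := iter i f d; pose b i := iter i f^-1%g (e d).
have n0 : 0 < n by rewrite lt0n card_porbit_neq0.
have fb i : f (b i.+1) = b i by rewrite /b iterS permKV.
have lab i : i < n -> l (a i) = linv (l (b i)).
  move=> i_n; have := congr1 (fun w => nth (l d) w i) Ew.
  rewrite face_word_winv nE [LHS](nth_map d) ?size_traject // nth_traject // -/(a i) => ->.
  by rewrite (nth_map (e d)) ?size_traject // nth_traject.
have bO i : b i \in porbit f (e d).
  by rewrite -porbitV; apply/porbitP; exists i; rewrite permX.
have aO i : a i \in porbit f d by rewrite /a -permX mem_porbit.
have disj : e d \notin porbit f d.
  apply/negP; rewrite porbit_traject => /trajectP [m mn xE].
  have bE i : i <= m -> b i = a (m - i).
    elim: i => [|i IH] im; first by rewrite subn0.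
    by apply: (@perm_inj _ f); rewrite fb (IH (ltnW im)) /a -iterS -subSn.
  have := odd_double_half m; case: (odd m) => mE.
    have := lab m./2.+1; rewrite bE; last by lia.
    have -> : m - m./2.+1 = m./2 by lia.
    by rewrite /a iterS => H; apply: (lred (a m./2)); apply: H; lia.
  have := lab m./2; rewrite bE; last by lia.
  have -> : m - m./2 = m./2 by lia.
  move=> H; have := linv_neq (l (a m./2)); rewrite -H ?eqxx //; lia.
have adj i j : a i != b j.
  apply: contraNneq disj => ab; rewrite porbit_sym -eq_porbit_mem.
  have := aO i; have := bO j; rewrite -ab -!eq_porbit_mem => /eqP -> /eqP ->.
  exact: eqxx.
have ai i j : i < n -> j < n -> a i = a j -> i = j.
  move=> i_n j_n; rewrite /a -(nth_traject f i_n) -(nth_traject f j_n).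
  by move/eqP; rewrite nth_uniq ?size_traject ?uniq_traject_porbit // => /eqP.
have bi i j : i < n -> j < n -> b i = b j -> i = j.
  move=> i_n j_n; rewrite /b -(nth_traject f^-1%g i_n) -(nth_traject f^-1%g j_n).
  move/eqP; rewrite nth_uniq ?size_traject // => [/eqP //|].
  by rewrite -nE -porbitV uniq_traject_porbit.
have [e' [pl' eK' le' e'a]] : exists e' : {perm D},
    [/\ planar e' f, involutive e', is_labelling e' l & forall i, i < n -> e' (a i) = b i].
  (* The dart d itself is glued to e d already; each further gluing takes place
     next to the previous one, where the two darts have a common end. *)
  suff : forall k, k < n -> exists e' : {perm D},
    [/\ planar e' f, involutive e', is_labelling e' l & forall i, i <= k -> e' (a i) = b i].
    move=> /(_ n.-1) [|e' [? ? ? H]]; first by lia.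
    by exists e'; split=> // i i_n; apply: H; lia.
  elim=> [|k IH] kn; first by exists e; split=> // -[].
  have [e' [pl' eK' le' e'a]] := IH (ltnW kn); have e1 := labelling_neq le'.
  have [ek|ek] := eqVneq (e' (a k.+1)) (b k.+1).
    exists e'; split=> // i; rewrite leq_eqVlt => /predU1P [-> //|]; exact: e'a.
  exists (rezip e' (a k.+1) (b k.+1)); split.
  - apply: planar_rezip => //.
    have e'b : e' (b k) = a k by rewrite -e'a // eK'.
    have -> : f (e' (a k.+1)) = ((e' * f) ^+ 2)%g (f (b k.+1)).
      by rewrite permX /= !permM fb e'b.
    exact: mem_porbit.
  - exact: rezip_involutive.
  - by apply: rezip_labelling; rewrite // lab // linvK.
  - move=> i ik; rewrite rezipE //.
    have [/ai->//|aik] := eqVneq (a i) (a k.+1); first by lia.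
    have {}ik : i <= k.
      by move: ik; rewrite leq_eqVlt => /predU1P [ik|//]; rewrite ik eqxx in aik.
    rewrite (negbTE (adj _ _)).
    have [E|_] := eqVneq (a i) (e' (a k.+1)).
      by have := adj k.+1 i; rewrite -(e'a i ik) E eK' eqxx.
    have [E|_] := eqVneq (a i) (e' (b k.+1)).
      by have := e'a i ik; rewrite E eK' => /bi; lia.
    exact: e'a.
have e'b i : i < n -> e' (b i) = a i by move=> i_n; rewrite -e'a // eK'.
pose J := (porbit f d :|: porbit f (e d))%SET.
have aP x : x \in porbit f d -> exists2 i, i < n & x = a i.
  by rewrite porbit_traject => /trajectP.
have bP x : x \in porbit f (e d) -> exists2 i, i < n & x = b i.
  by rewrite -porbitV porbit_traject porbitV nE => /trajectP.
have fJ x : (f x \in J) = (x \in J).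
  by rewrite !inE -!eq_porbit_mem porbit_stepE.
have eJ1 x : x \in J -> e' x \in J.
  rewrite !inE => /orP [/aP|/bP] [i i_n ->].
    by rewrite e'a // bO orbT.
  by rewrite e'b // aO.
have eJ x : (e' x \in J) = (x \in J).
  by apply/idP/idP => [/eJ1|/eJ1 //]; rewrite eK'.
have [||||||D' [e2 [f2 [l2 [o2 [? ? ?]]]]]] :=
    @diagram_restrict D e' f l o (~: J)%SET pl' eK' le'.
- by move=> x; rewrite !finset.in_setC eJ.
- by move=> x; rewrite !finset.in_setC fJ.
- by apply/eqP => /setP /(_ d); rewrite !inE porbit_id.
- by rewrite !inE negb_or porbit_sym dO porbit_sym xO.
- rewrite finset.setCK.
  have cJ : #|J| = n + n.
    rewrite cardsU nE -/n (_ : _ :&: _ = finset.set0)%SET ?cards0 ?subn0 //.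
    apply/setP => x; rewrite !inE; apply/negP => /andP [/aP [i _ ->] /bP [j _ ab]].
    by have := adj i j; rewrite ab eqxx.
  have F2 : #|[set porbit f x | x in J]%SET| <= 2.
    apply: leq_trans (_ : #|[set porbit f d; porbit f (e d)]%SET| <= 2); last first.
      by rewrite cards2; case: (_ != _).
    apply: subset_leq_card; apply/fintype.subsetP => _ /imsetP [x xJ ->].
    by rewrite !inE !eq_porbit_mem; move: xJ; rewrite !inE.
  (* The darts b i and a i.+1 are at one vertex, so the face of d meets all of them. *)
  have V2 : #|[set porbit (e' * f)%g x | x in J]%SET| <= n.
    apply: leq_trans (leq_imset_card (porbit (e' * f)%g) (porbit f d)).
    apply: subset_leq_card; apply/fintype.subsetP => _ /imsetP [x xJ ->].
    move: xJ; rewrite !inE => /orP [xO'|/bP [i i_n ->]]; first exact: imset_f.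
    rewrite -(porbit_stepE _ (b i)) permM e'b // -[f _]/(a i.+1).
    exact: imset_f.
  by rewrite cJ; lia.
- move=> x xJ; exact: fa.
by exists D', e2, f2, l2, o2.
Qed.

End Diagram.

(** * Curvature *)

Lemma leq_sum_porbits (D : finType) (s : {perm D}) (A : {set D}) (g : D -> nat) c :
  (forall x, x \in A -> s x \in A) ->
  (forall x, x \in A -> c <= \sum_(y in porbit s x) g y) ->
  c * #|[set porbit s x | x in A]%SET| <= \sum_(x in A) g x.
Proof.
move=> sA gc; rewrite (partition_big (porbit s) (mem [set porbit s x | x in A]%SET)) /=; last first.
  by move=> x xA; apply: imset_f.
rewrite mulnC -sum_nat_const; apply: leq_sum => _ /imsetP [x xA ->].
apply: leq_trans (gc x xA) _; rewrite leq_eqVlt; apply/orP; left; apply/eqP.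
apply: eq_bigl => y; rewrite eq_porbit_mem; apply/idP/andP => [yx|[_ //]]; split=> //.
move: yx => /porbitP [i ->]; rewrite permX.
by elim: i => //= i; apply: sA.
Qed.

Section CyclicallyReduced.
Variables (X : choiceType) (r : set (word X)).
Hypothesis hr : relator_set r.

Lemma cyc_reduced_winv (w : word X) : cyc_reduced (winv w) = cyc_reduced w.
Proof.
rewrite /cyc_reduced /winv rev_cycle cycle_map; apply: eq_cycle => a b /=.
by rewrite linvK eq_sym.
Qed.

Lemma symm_closure_cyc_reduced w : symm_closure r w -> cyc_reduced w.
Proof.
move=> [v /hr [_ cv] [n [->|->]]]; rewrite /cyc_reduced rot_cycle //.
by rewrite -/(cyc_reduced _) cyc_reduced_winv.
Qed.

Lemma symm_closure_neq0 w : symm_closure r w -> w <> [::].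
Proof.
move=> [v /hr [v0 _] [n E]] w0; apply: v0; apply/eqP; rewrite -size_eq0.
by case: E => E; have := congr1 size E; rewrite w0 size_rot ?size_winv => <-.
Qed.

Lemma cyc_reduced_face (D : finType) (f : {perm D}) (l : D -> letter X) x :
  cyc_reduced (face_word f l x) -> l (f x) <> linv (l x).
Proof.
have := fcycle_traject_porbit f x; rewrite /face_word /cyc_reduced.
have [p ->] := traject_porbit_cons f x.
case: p => [|y p] /= /andP [/eqP -> _] /andP [/eqP //].
Qed.

End CyclicallyReduced.

Section Curvature.
Variables (X : choiceType) (r : set (word X)) (q : nat).
Hypothesis hr : relator_set r.
Hypothesis hq : q = 6 \/ (q = 4 /\ T4 r).
Hypothesis hC : forall R p, symm_closure r R -> prefix p R -> piece r p ->
  q * size p < size R.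

Variables (D : finType) (e f : {perm D}) (l : D -> letter X) (o : D).
Hypothesis dg : diagram r e f l o.
Hypothesis outer_red : cyc_reduced (face_word f l o).
Hypothesis outer_star : forall n V R, prefix V (rot n (face_word f l o)) ->
  symm_closure r R -> infix V R -> 2 * size V <= size R.
Hypothesis no_mirror : forall d, d \notin porbit f o -> e d \notin porbit f o ->
  face_word f l d <> winv (face_word f l (f (e d))).

Let O := porbit f o.
Let v := (e * f)%g.

Lemma diagram_reduced x : l (f x) <> linv (l x).
Proof.
apply: cyc_reduced_face; case: (boolP (x \in O)) => [xO|/(diagram_face dg)].
  by have [n ->] := face_word_iter l xO; rewrite /cyc_reduced rot_cycle.
exact: symm_closure_cyc_reduced.
Qed.

Let eK : involutive e. Proof. exact: diagram_edge dg. Qed.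
Let le x : l (e x) = linv (l x). Proof. exact: (diagram_label dg). Qed.

Let fO x : (f x \in O) = (x \in O).
Proof. by rewrite -!eq_porbit_mem porbit_stepE. Qed.

(** A vertex of degree one would put a letter next to its inverse in a face. *)
Lemma degree_ge2 x : 1 < #|porbit v x|.
Proof.
have vx : v x != x.
  rewrite permM; apply/eqP => E; apply: (@diagram_reduced (e x)).
  by rewrite E le linvK.
rewrite (cardsD1 x) porbit_id ltnS card_gt0; apply/set0Pn; exists (v x).
by rewrite in_setD1 vx porbit_step.
Qed.

Let theta := q./2.+1.
Let outer_corners x := #|porbit v x :&: O|%SET.

(** The angle of the corner at the tail of x, in units of pi / 6.  Outer corners
    are straight, so that the outer face has curvature 2 pi; a vertex visited
    more than once by the outer face has 2 pi from that already; vertices of degree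
    two are straight; the remaining corners are pi / 2 on the boundary, and in
    the interior 2 pi / 3 for q = 6 and pi / 2 for q = 4. *)
Definition angle x :=
  if x \in O then 6 else
  if 1 < outer_corners x then 0 else
  if #|porbit v x| == 2 then 6 else
  if outer_corners x == 1 then 3 else theta.

(** At a vertex of degree three the three faces cancel pairwise, against T(4). *)
Lemma interior_degree3 x : #|porbit v x| = 3 -> outer_corners x = 0 -> q = 6.
Proof.
move=> x3 x0; case: hq => // -[_ t4].
have xO y : y \in porbit v x -> y \notin O.
  move=> yx; apply: contra_eqN x0 => yO; rewrite -lt0n card_gt0.
  by apply/set0Pn; exists y; rewrite inE yx.
have x1 : x \notin O by apply: xO; exact: porbit_id.
have x2 : v x \notin O by apply: xO; exact: porbit_step.
have x3' : v (v x) \notin O by apply: xO; have := mem_porbit v 2 x; rewrite permX.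
have v3 : v (v (v x)) = x by have := iter_porbit v x; rewrite x3.
have nm y : y \notin O -> v y \notin O -> face_word f l y <> winv (face_word f l (v y)).
  by move=> yO vyO; rewrite [v y]permM; apply: no_mirror => //; rewrite -fO -permM.
(* The last letter of the word read at v y is the inverse of the first one read at y. *)
have nred y : ~~ reduced (face_word f l (v y) ++ face_word f l y).
  have [s ->] : exists s, face_word f l (v y) = rcons s (linv (l y)).
    rewrite [v y]permM face_word_step -le /face_word.
    have [p ->] := traject_porbit_cons f (e y).
    by rewrite rot1_cons; eexists.
  have [t ->] : exists t, face_word f l y = l y :: t.
    by rewrite /face_word; have [p ->] := traject_porbit_cons f y; eexists.
  rewrite /reduced; case: s => [|b s] /=; first by rewrite linvK eqxx.
  by rewrite -cats1 -catA cat_path /= linvK eqxx !andbF.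
have fS y : y \notin O -> symm_closure r (face_word f l y) by apply: (diagram_face dg).
case: (t4 _ _ _ (fS _ x3') (fS _ x2) (fS _ x1)).
- exact: nm.
- exact: nm.
- by have := nm (v (v x)); rewrite v3; apply.
- by rewrite (negbTE (nred _)).
- by rewrite (negbTE (nred _)).
- by have := nred (v (v x)); rewrite v3 => /negbTE ->.
Qed.

Lemma vertex_angle x : 12 <= \sum_(y in porbit v x) angle y.
Proof.
have px y : y \in porbit v x -> porbit v y = porbit v x by rewrite -eq_porbit_mem => /eqP.
pose c := if 1 < outer_corners x then 0 else if #|porbit v x| == 2 then 6 else
  if outer_corners x == 1 then 3 else theta.
have -> : \sum_(y in porbit v x) angle y =
    outer_corners x * 6 + (#|porbit v x| - outer_corners x) * c.
  rewrite (bigID (mem O)) /=; congr (_ + _).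
    rewrite -sum_nat_const; apply: eq_big => [y|y /andP [_ yO]]; first by rewrite inE.
    by rewrite /angle yO.
  have <- : #|porbit v x :\: O|%SET = #|porbit v x| - outer_corners x by rewrite cardsD.
  rewrite -sum_nat_const; apply: eq_big => [y|y /andP [yx yO]].
    by rewrite inE andbC.
  by rewrite /angle (negbTE yO) /outer_corners px.
have := degree_ge2 x; have := @interior_degree3 x.
have : outer_corners x <= #|porbit v x| by apply: subset_leq_card; exact: subsetIl.
have qv : q = 6 \/ q = 4 by case: hq => [->|[->]]; [left|right].
rewrite /c /theta.
move: (outer_corners x) #|porbit v x| => k n kn H n2.
case: (leqP 2 k) => k1; first by nia.
case: eqP => n2'; first by nia.
case: eqP => k1'; first by nia.
have k0 : k = 0 by lia.
by have [n3|n3] : n = 3 \/ 4 <= n; [lia|rewrite (H n3 k0) n3 k0|case: qv => ->; nia].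
Qed.

Let on_boundary x := e x \in O.
Let defect x := 6 - angle x.

Lemma theta_cases : (q = 6 /\ theta = 4) \/ (q = 4 /\ theta = 3).
Proof. by rewrite /theta; case: hq => [->|[-> _]]; [left|right]. Qed.

(** A straight corner of an inner face is at a vertex of degree two, so the two
    edges at it separate the same two faces. *)
Lemma flat_corner x : x \notin O -> defect x = 0 -> e (f^-1%g x) = f (e x).
Proof.
move=> xO; rewrite /defect /angle (negbTE xO).
case: (leqP 2 _) => // k1; case: eqP => [n2 _|_]; last first.
  by case: eqP => // _; case: theta_cases => -[_ ->].
have := iter_porbit v x; rewrite n2 /= {1}/v permM => v2.
by rewrite -[in LHS]v2 permK eK permM.
Qed.

Lemma flat_corner_bd x : x \notin O -> defect x = 0 -> on_boundary (f^-1%g x) = on_boundary x.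
Proof. by move=> xO /(flat_corner xO); rewrite /on_boundary => ->; rewrite fO. Qed.

(** A corner between two boundary arcs is at a vertex that the outer face visits
    twice: this is why each end of a boundary arc is worth pi / 2. *)
Lemma corner_defect x : x \notin O -> 0 < defect x ->
  3 * on_boundary x + 3 * on_boundary (f^-1%g x) <= defect x /\ 6 - theta <= defect x.
Proof.
move=> xO; rewrite /defect /angle (negbTE xO).
case: (leqP 2 _) => k1; first by move=> _; case: (on_boundary x) (on_boundary (f^-1%g x)) => [] [] /=; lia.
case: eqP => // n2.
have vx : on_boundary x = (v x \in O) by rewrite permM fO.
have vpx : on_boundary (f^-1%g x) = (v^-1%g x \in O).
  suff -> : v^-1%g x = e (f^-1%g x) by [].
  by apply: (@perm_inj _ v); rewrite permKV permM eK permKV.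
have vV : v x != v^-1%g x.
  apply/eqP => E; have xv : v (v x) = x by rewrite E permKV.
  have vxx : v x != x.
    have := degree_ge2 x; apply: contraTneq => vxx.
    have U : uniq [:: x] by [].
    have C : fcycle v [:: x] by rewrite /= vxx eqxx.
    by rewrite (eq_card (porbit_fcycle U C)); move/card_uniqP: U => ->.
  have U : uniq [:: x; v x] by rewrite /= inE eq_sym vxx.
  have C : fcycle v [:: x; v x] by rewrite /= xv !eqxx.
  by apply: n2; rewrite (eq_card (porbit_fcycle U C)); move/card_uniqP: U => /= ->.
have nb : ~~ (on_boundary x && on_boundary (f^-1%g x)).
  rewrite vx vpx; apply: contraL k1 => /andP [b1 b2]; rewrite -leqNgt.
  apply: leq_trans (_ : #|[set v x; v^-1%g x]%SET| <= _); first by rewrite cards2 vV.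
  apply: subset_leq_card; apply/fintype.subsetP => y; rewrite !inE => /orP [] /eqP ->.
    by rewrite porbit_step.
  by rewrite b2 -porbitV porbit_step.
have bk : on_boundary x || on_boundary (f^-1%g x) -> 0 < outer_corners x.
  rewrite vx vpx card_gt0 => /orP [] b; apply/set0Pn.
    by exists (v x); rewrite inE porbit_step.
  by exists (v^-1%g x); rewrite inE b -porbitV porbit_step.
move: nb bk; case: (on_boundary x) (on_boundary (f^-1%g x)) => [] [] //= _ bk.
- have := bk isT; have -> : outer_corners x == 1 by have := bk isT; lia.
  by case: theta_cases => -[_ ->].
- have := bk isT; have -> : outer_corners x == 1 by have := bk isT; lia.
  by case: theta_cases => -[_ ->].
by move=> _; split=> //; case: eqP => // _; case: theta_cases => -[_ ->].
Qed.

Lemma flat_run x j : x \notin O -> (forall i, 0 < i <= j -> defect (iter i f x) = 0) ->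
  traject f^-1%g (e x) j.+1 = map e (traject f x j.+1).
Proof.
move=> xO fl.
have xOi i : iter i f x \notin O by elim: i => //= i; rewrite fO.
have H i : i <= j -> iter i f^-1%g (e x) = e (iter i f x).
  elim: i => // i IH ij; rewrite iterS IH ?(ltnW ij) //.
  apply: (@perm_inj _ f); rewrite permKV.
  have := @flat_corner (iter i.+1 f x) (xOi _) (fl i.+1 ij).
  by rewrite {1}iterS permK.
apply: (@eq_from_nth _ x); rewrite ?size_map ?size_traject // => i ij.
rewrite (nth_map x) ?size_traject // nth_traject // (set_nth_default (e x)) ?size_traject //.
by rewrite nth_traject // H.
Qed.

Lemma flat_run_size x j : x \notin O -> j < #|porbit f x| ->
  (forall i, 0 < i <= j -> defect (iter i f x) = 0) -> j < #|porbit f (e x)|.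
Proof.
move=> xO jn fl.
have U : uniq (traject f x j.+1).
  by rewrite -(take_traject f x jn) take_uniq // uniq_traject_porbit.
have : uniq (traject f^-1%g (e x) j.+1).
  by rewrite flat_run // map_inj_uniq //; exact: perm_inj.
move/card_uniqP; rewrite size_traject => <-; apply: subset_leq_card.
apply/fintype.subsetP => y /trajectP [i _ ->].
by rewrite -porbitV -permX mem_porbit.
Qed.

(** The run is read in both faces, from different relators as there is no mirror
    pair, so it is a piece. *)
Lemma interior_run x j : x \notin O -> ~~ on_boundary x -> j < #|porbit f x| ->
  (forall i, 0 < i <= j -> defect (iter i f x) = 0) -> q * j.+1 < #|porbit f x|.
Proof.
move=> xO xb jn fl; have jn' := flat_run_size xO jn fl.
have R1 : symm_closure r (face_word f l x) by apply: (diagram_face dg).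
have R2 : symm_closure r (winv (face_word f l (f (e x)))).
  by apply: symm_closure_inv; apply: (diagram_face dg); rewrite fO.
pose p := map l (traject f x j.+1).
have p1 : prefix p (face_word f l x).
  by rewrite /face_word -(cat_take_drop j.+1 (traject _ _ _)) take_traject // map_cat prefix_prefix.
have p2 : prefix p (winv (face_word f l (f (e x)))).
  rewrite face_word_winv -(cat_take_drop j.+1 (traject _ _ _)) take_traject //.
  rewrite flat_run // map_cat -map_comp (_ : map _ (traject f x _) = p) ?prefix_prefix //.
  by apply: eq_map => y /=; rewrite le linvK.
have := hC R1 p1; rewrite size_face_word size_map size_traject; apply.
split=> //; exists (face_word f l x), (winv (face_word f l (f (e x)))); split=> //.
exact: no_mirror.
Qed.

(** The run is read inversely along the outer face. *)
Lemma boundary_run x j : x \notin O -> on_boundary x -> j < #|porbit f x| ->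
  (forall i, 0 < i <= j -> defect (iter i f x) = 0) -> 2 * j.+1 <= #|porbit f x|.
Proof.
move=> xO xb jn fl; have jn' := flat_run_size xO jn fl.
have R1 : symm_closure r (face_word f l x) by apply: (diagram_face dg).
pose p := map l (traject f x j.+1).
have p1 : prefix p (face_word f l x).
  by rewrite /face_word -(cat_take_drop j.+1 (traject _ _ _)) take_traject // map_cat prefix_prefix.
pose z := iter j f^-1%g (e x).
have zO : z \in O.
  have zx : z \in porbit f (e x) by rewrite -porbitV ?/z -permX mem_porbit.
  by rewrite -eq_porbit_mem in zx; rewrite -eq_porbit_mem (eqP zx) eq_porbit_mem.
have oz : porbit f z = porbit f (e x).
  by apply/eqP; rewrite eq_porbit_mem -porbitV /z -permX mem_porbit.
have zt : traject f z j.+1 = rev (traject f^-1%g (e x) j.+1).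
  have zi i : i <= j -> iter i f z = iter (j - i) f^-1%g (e x).
    elim: i => [|i IH] ij; first by rewrite subn0.
    by rewrite iterS (IH (ltnW ij)) -{1}(subnSK ij) iterS permKV.
  apply: (@eq_from_nth _ z); rewrite ?size_rev !size_traject // => i ij.
  rewrite nth_traject // zi // nth_rev size_traject // (set_nth_default (e x)) ?size_traject //.
    by rewrite nth_traject //; lia.
  lia.
have [m Em] := face_word_iter l zO.
have pz : prefix (winv p) (rot m (face_word f l o)).
  rewrite -Em /face_word oz -(cat_take_drop j.+1 (traject _ _ _)) take_traject // zt flat_run //.
  rewrite map_cat map_rev -map_comp (_ : rev _ = winv p) ?prefix_prefix //.
  by rewrite /winv /p -map_comp; congr rev; apply: eq_map => y /=; rewrite le.
have := outer_star pz (symm_closure_inv R1).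
rewrite !size_winv size_face_word size_map size_traject; apply.
case/prefixP: p1 => t ->; rewrite winv_cat; apply/infixP.
by exists (winv t), [::]; rewrite cats0.
Qed.

(** I and B count the interior and the boundary arcs of a face of length n, whose
    lengths are at most MI and MB, and S is its total defect.  With B = 0 there
    are more than q interior arcs, with B = 1 more than q / 2, and two boundary
    arcs suffice by themselves. *)
Lemma face_arith n I B MI MB S :
  0 < n -> q * MI < n -> 2 * MB <= n -> n <= I * MI + B * MB ->
  6 * B <= S -> 6 * B + (6 - theta) * I <= S + (6 - theta) * B -> 12 <= S.
Proof.
move=> n0 hI hB hn S1 S2.
have [B2|B1] := leqP 2 B; first by lia.
have [B0|B1'] : B = 0 \/ B = 1 by lia.
  have Iq : q < I by rewrite ltnNge; apply/negP => Iq; nia.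
  by case: theta_cases Iq S2 => -[-> ->]; rewrite B0; lia.
have Iq : q < 2 * I by rewrite ltnNge; apply/negP => Iq; nia.
by case: theta_cases Iq S2 => -[-> ->]; rewrite B1'; lia.
Qed.

Lemma card_runs (A : {set D}) M :
  #|[set iter (val u.2) f u.1 | u in finset.setX A [set: 'I_M]]%SET| <= #|A| * M.
Proof.
apply: leq_trans (leq_imset_card _ _) _.
by rewrite cardsX cardsT card_ord.
Qed.

(** Every dart lies on the run that starts at the last corner before it, so the
    corners with positive defect cut the face into arcs.  Boundary arcs have as
    many ends as beginnings, because the kind of a dart can only change at such
    a corner. *)
Lemma face_defect x : x \notin O -> 12 <= \sum_(y in porbit f x) defect y.
Proof.
move=> xO; set P := porbit f x; pose n := #|P|.
have PO y : y \in P -> y \notin O.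
  by rewrite -!eq_porbit_mem => /eqP ->; rewrite eq_porbit_mem.
have Pn y : y \in P -> #|porbit f y| = n by rewrite -eq_porbit_mem => /eqP ->.
have fP y : (f y \in P) = (y \in P) by rewrite -!eq_porbit_mem porbit_stepE.
have n0 : 0 < n by rewrite lt0n card_porbit_neq0.
have q0 : 0 < q by case: theta_cases => -[->].
pose C := [set y in P | 0 < defect y]%SET.
pose CB := [set y in C | on_boundary y]%SET; pose CI := [set y in C | ~~ on_boundary y]%SET.
(* The greatest lengths allowed by [interior_run] and [boundary_run]. *)
pose MI := n.-1 %/ q; pose MB := n./2.
have run_C y j : y \in P -> j < n -> (forall i, 0 < i <= j -> iter i f y \notin C) ->
    j < (if on_boundary y then MB else MI).
  move=> yP jn fl.
  have fl' i : 0 < i <= j -> defect (iter i f y) = 0.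
    move=> /fl; rewrite inE lt0n -[iter i f y \in P]/(_ \in P).
    have -> : iter i f y \in P by elim: (i) => //= k; rewrite fP.
    by rewrite /= negbK => /eqP.
  case: ifP => [yb|/negbT yb].
    by have := boundary_run (PO y yP) yb; rewrite Pn // => /(_ j jn fl'); rewrite /MB; lia.
  have := interior_run (PO y yP) yb; rewrite Pn // => /(_ j jn fl') H.
  by rewrite /MI leq_divRL // mulnC; lia.
(* Without corners the whole face would be a single run. *)
have [C0|/set0Pn [c cC]] := eqVneq C finset.set0.
  have xP : x \in P by exact: porbit_id.
  have : n.-1 < (if on_boundary x then MB else MI).
    by apply: run_C => //; [lia|move=> i _; rewrite C0 inE].
  by case: ifP => _; [rewrite /MB; lia|rewrite ltnNge leq_div].
have cover y : y \in P -> exists c j, [/\ c \in C, y = iter j f c & j < if on_boundary c then MB else MI].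
  move=> yP.
  have ex : exists j, [exists c, (c \in C) && (iter j f c == y)].
    have : y \in porbit f c.
      by move: cC yP; rewrite inE -!eq_porbit_mem => /andP [/eqP -> _] /eqP ->.
    rewrite porbit_traject => /trajectP [j _ ->]; exists j; apply/existsP; exists c.
    by rewrite cC eqxx.
  (* The nearest corner before y; the minimality of j makes the run flat. *)
  case: (ex_minnP ex) => j /existsP [b /andP [bC /eqP jb]] jmin.
  have bP : b \in P by move: bC; rewrite inE => /andP [].
  exists b, j; split=> //; apply: run_C => //.
    rewrite ltnNge; apply/negP => nj.
    have := jmin (j - n); rewrite leqNgt ltn_subrL n0 (leq_trans n0 nj) /= => /(_ _) H.
    suff : false by []; apply: H; apply/existsP; exists b; rewrite bC /=.
    have nb : iter n f b = b by rewrite -(Pn b bP) iter_porbit.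
    by rewrite -jb -{2}(subnK nj) iterD nb.
  move=> i /andP [i0 ij]; apply/negP => iC.
  have : j <= j - i.
    apply: jmin; apply/existsP; exists (iter i f b).
    by rewrite iC -iterD subnK // jb eqxx.
  lia.
have hn : n <= #|CI| * MI + #|CB| * MB.
  apply: leq_trans (leq_add (card_runs CI MI) (card_runs CB MB)).
  apply: leq_trans (leq_card_setU _ _).
  apply: subset_leq_card; apply/fintype.subsetP => y /cover [b [j [bC -> jb]]].
  rewrite inE; case: ifP jb => bb jb; apply/orP; [right|left];
  apply/imsetP; exists (b, Ordinal jb) => //; by rewrite finset.in_setX finset.in_setT andbT /= inE bC bb.
set S := \sum_(y in P) defect y.
have SC : \sum_(y in C) defect y = S.
  rewrite /S [RHS](bigID (fun y => 0 < defect y)) /= [X in _ = _ + X]big1 ?addn0; last first.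
    by move=> y /andP [_]; rewrite lt0n negbK => /eqP.
  by apply: eq_bigl => y; rewrite inE.
have sB : \sum_(y in C) on_boundary y = #|CB|.
  rewrite -sum1_card [RHS](eq_bigl (fun y => (y \in C) && on_boundary y)); last by move=> y; rewrite inE.
  by rewrite big_mkcondr /=; apply: eq_bigr => y _; case: (on_boundary y).
have sI : \sum_(y in C) ~~ on_boundary y = #|CI|.
  rewrite -sum1_card [RHS](eq_bigl (fun y => (y \in C) && ~~ on_boundary y)); last by move=> y; rewrite inE.
  by rewrite big_mkcondr /=; apply: eq_bigr => y _; case: (on_boundary y).
have sB' : \sum_(y in C) on_boundary (f^-1%g y) = #|CB|.
  have E : \sum_(y in P) on_boundary (f^-1%g y) = \sum_(y in P) on_boundary y.
    rewrite [LHS](reindex_inj (@perm_inj _ f)) /=; apply: eq_big => y; first by rewrite fP.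
    by rewrite permK.
  have Eb b : \sum_(y in P) (b : D -> bool) y = \sum_(y in C) b y + \sum_(y in P | defect y == 0) b y.
    rewrite (bigID (fun y => 0 < defect y)) /=; congr (_ + _); apply: eq_bigl => y.
      by rewrite inE.
    by rewrite lt0n negbK.
  move: E; rewrite (Eb (fun y => on_boundary (f^-1%g y))) (Eb on_boundary) sB.
  have -> : \sum_(y in P | defect y == 0) on_boundary (f^-1%g y) =
      \sum_(y in P | defect y == 0) on_boundary y.
    by apply: eq_bigr => y /andP [yP /eqP y0]; rewrite flat_corner_bd // PO.
  exact: addIn.
have CP y : y \in C -> y \notin O /\ 0 < defect y by rewrite inE => /andP [/PO].
apply: (face_arith n0 _ _ hn).
- by rewrite /MI; have := leq_trunc_div n.-1 q; rewrite mulnC; lia.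
- by rewrite /MB; lia.
- rewrite -SC (_ : 6 * _ = 3 * #|CB| + 3 * #|CB|); last by lia.
  rewrite -{1}sB -sB' !big_distrr -big_split /=; apply: leq_sum => y /CP [yO y0].
  by have [] := corner_defect yO y0.
rewrite -SC (_ : 6 * _ = 3 * #|CB| + 3 * #|CB|); last by lia.
rewrite -{1}sB -sI -sB' !big_distrr -!big_split /=; apply: leq_sum => y /CP [yO y0].
have [] := corner_defect yO y0.
by case: (on_boundary y) (on_boundary _) theta_cases => [] [] [] [_ ->] /=; lia.
Qed.

(** Angles and defects of the inner corners add up to pi each; compare the sums
    over vertices and over faces with Euler's formula. *)
Lemma no_reduced_diagram : False.
Proof.
have V : 12 * #|porbits v| <= \sum_x angle x.
  have := @leq_sum_porbits D v [set: D]%SET angle 12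
    (fun _ _ => finset.in_setT _) (fun x _ => vertex_angle x).
  rewrite (eq_bigl xpredT) => [|y]; last exact: finset.in_setT.
  apply: leq_trans; rewrite leq_mul2l /=; apply: subset_leq_card.
  by apply/fintype.subsetP => _ /imsetP [x _ ->]; apply: imset_f; exact: finset.in_setT.
have nO x : x \in ~: O -> f x \in ~: O by rewrite !finset.in_setC fO.
have F : 12 * #|[set porbit f x | x in ~: O]%SET| <= \sum_(x in ~: O) defect x.
  by apply: leq_sum_porbits nO _ => x; rewrite finset.in_setC; exact: face_defect.
have F1 : #|porbits f| = #|[set porbit f x | x in ~: O]%SET|.+1.
  have fO' x : x \in O -> f x \in O by rewrite fO.
  rewrite (card_porbits_closed fO') -add1n; congr (_ + _).
  rewrite (_ : [set _ | x in O]%SET = [set O]%SET) ?cards1 //.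
  apply/setP => B; rewrite inE; apply/imsetP/eqP => [[x xO ->]|->].
    by apply/eqP; rewrite eq_porbit_mem.
  by exists o; rewrite ?porbit_id.
have S : \sum_x angle x + \sum_(x in ~: O) defect x = 6 * #|D|.
  rewrite (bigID (mem O)) /= -addnA.
  rewrite (eq_bigl (fun x => x \notin O) defect) => [|x]; last by rewrite finset.in_setC.
  rewrite -big_split /= -(cardC O) mulnDr; congr (_ + _).
    rewrite mulnC -sum_nat_const; apply: eq_bigr => x xO; by rewrite /angle xO.
  rewrite mulnC -sum_nat_const; apply: eq_bigr => x xO; rewrite subnKC //.
  rewrite /angle (negbTE xO); do 3![case: ifP => // _].
  by case: theta_cases => -[_ ->].
(* A single colour: only the bound by one component is used. *)
have := diagram_planar dg (c := fun=> tt) (fun=> erefl) (fun=> erefl).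
have : 0 < #|[set tt | x in D]%SET|.
  by rewrite card_gt0; apply/set0Pn; exists tt; apply/imsetP; exists o.
rewrite F1 -/v; move: V F S; set A := #|_|; set B := #|_|; set C := #|_|; set E := #|_|.
by move=> *; lia.
Qed.

End Curvature.

(** Removing mirror pairs makes the diagram smaller, so one ends with a diagram
    that has none. *)
Theorem cyc_star_reduced_nontrivial (X : choiceType) (r : set (word X)) q (w : word X) :
  relator_set r -> q = 6 \/ (q = 4 /\ T4 r) ->
  (forall R p, symm_closure r R -> prefix p R -> piece r p -> q * size p < size R) ->
  w <> [::] -> cyc_reduced w ->
  (forall n V R, prefix V (rot n w) -> symm_closure r R -> infix V R ->
    2 * size V <= size R) ->
  ~ pres_eq r w [::].
Proof.
move=> hr hq hC w0 cw sw triv.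
have [|D [e [f [l [o [dg W]]]]]] := bounds_trivial _ w0 triv; first by move=> R /hr [].
have [n] := ubnP #|D|; elim: n D e f l o dg W => // n IH D e f l o dg W Dn.
rewrite -W in cw sw.
have [[d [dO xO Ed]]|nm] := pselect (exists d, [/\ d \notin porbit f o, e d \notin porbit f o &
    face_word f l d = winv (face_word f l (f (e d)))]).
  have red := diagram_reduced hr dg cw.
  have [D' [e' [f' [l' [o' [DD dg' W']]]]]] := diagram_mirror dg red dO xO Ed.
  by apply: (IH D' e' f' l' o' dg'); [rewrite W' | apply: leq_trans DD _].
by apply: (no_reduced_diagram hr hq hC dg cw sw) => d dO xO Ed; apply: nm; exists d.
Qed.

(** * Free reduction *)

Section FreeReduction.
Variable X : choiceType.
Implicit Types (a b : letter X) (u v w p q : word X).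

Definition push a w : word X :=
  if w is b :: t then if b == linv a then t else a :: w else [:: a].

Definition red u : word X := foldr push [::] u.

Lemma reduced_push a w : reduced w -> reduced (push a w).
Proof.
case: w => //= b t bt; case: eqP => [_|/eqP ba /=]; last by rewrite ba.
exact: path_sorted bt.
Qed.

Lemma reduced_red u : reduced (red u).
Proof. by elim: u => //= a u; apply: reduced_push. Qed.

Lemma red_id u : reduced u -> red u = u.
Proof.
elim: u => //= a u IH au; rewrite IH; last exact: path_sorted au.
by case: u au {IH} => //= b u /andP [/negbTE ->].
Qed.

Lemma pushK a w : reduced w -> push a (push (linv a) w) = w.
Proof.
case: w => [|b t] /=; first by rewrite eqxx.
rewrite linvK; case: eqP => [->|_ _] /=; last by rewrite eqxx.
by case: t => [|c t] //= /andP [/negbTE ->].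
Qed.

Lemma red_cat u v : red (u ++ v) = foldr push (red v) u.
Proof. exact: foldr_cat. Qed.

Lemma red_cancel_step u v : cancel_step u v -> red u = red v.
Proof. by case=> p q a; rewrite !red_cat /= pushK // reduced_red. Qed.

Definition cancels := clos_refl_trans _ (@cancel_step X).

Lemma cancels_red u v : cancels u v -> red u = red v.
Proof.
elim=> [x y /red_cancel_step //|//|x y z _ -> _ -> //].
Qed.

Lemma cancel_step_ctx p q u v : cancel_step u v -> cancel_step (p ++ u ++ q) (p ++ v ++ q).
Proof.
case=> p' q' a; have := CancelStep (p ++ p') (q' ++ q) a.
by rewrite -!catA.
Qed.

Lemma cancels_ctx p q u v : cancels u v -> cancels (p ++ u ++ q) (p ++ v ++ q).
Proof.
elim=> [x y xy|x|x y z _ xy _ yz].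
- exact/rt_step/cancel_step_ctx.
- exact: rt_refl.
- exact: rt_trans xy yz.
Qed.

Lemma cancels_to_red u : cancels u (red u).
Proof.
elim: u => [|a u IH]; first exact: rt_refl.
apply: (@rt_trans _ _ _ (a :: red u)).
  by have := cancels_ctx [:: a] [::] IH; rewrite !cats0.
rewrite /=; case: (red u) => [|b t] /=; first exact: rt_refl.
case: eqP => [->|_]; last exact: rt_refl.
exact/rt_step/(CancelStep [::] t a).
Qed.

Lemma free_reduction_red u v : free_reduction u v -> v = red u.
Proof. by move=> [/cancels_red -> /red_id]. Qed.

Lemma red_free_reduction u : free_reduction u (red u).
Proof. by split; [exact: cancels_to_red | exact: reduced_red]. Qed.

Lemma red_ctx p q u v : red u = red v -> red (p ++ u ++ q) = red (p ++ v ++ q).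
Proof.
move=> uv; rewrite (cancels_red (cancels_ctx p q (cancels_to_red u))) uv.
by rewrite -(cancels_red (cancels_ctx p q (cancels_to_red v))).
Qed.

Lemma red_winv u : red (winv u ++ u) = [::].
Proof.
elim: u => //= a u IH; rewrite winv_cons cat_rcons.
have := red_cancel_step (CancelStep (winv u) u (linv a)).
by rewrite linvK IH.
Qed.

Lemma red_winvr u : red (u ++ winv u) = [::].
Proof. by have := red_winv (winv u); rewrite winvK. Qed.

(** Cancellation never moves letters across a cut, so every factorisation of the
    result lifts.  This relates the cyclic shifts of a word to those of its
    reduction. *)
Lemma cancels_split u v : cancels u v -> forall v1 v2, v = v1 ++ v2 ->
  exists u1 u2, [/\ u = u1 ++ u2, cancels u1 v1 & cancels u2 v2].
Proof.
elim=> [_ _ [p q a]|x|x y z _ IH1 _ IH2] v1 v2.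
- move=> E; have [pv|vp] := leqP (size v1) (size p).
    have [t pE] : exists t, p = v1 ++ t.
      exists (drop (size v1) p); have := congr1 (take (size v1)) E.
      by rewrite takel_cat // take_size_cat // => {1}<-; rewrite cat_take_drop.
    have v2E : v2 = t ++ q.
      by apply/eqP; move/eqP: E; rewrite pE -catA eqseq_cat // eqxx eq_sym => /andP [].
    exists v1, (t ++ [:: a; linv a] ++ q); split.
    - by rewrite pE -catA.
    - exact: rt_refl.
    - by rewrite v2E; apply/rt_step/CancelStep.
  have [t v1E] : exists t, v1 = p ++ t.
    exists (drop (size p) v1); have := congr1 (take (size p)) E.
    by rewrite take_size_cat // takel_cat ?(ltnW vp) // => {1}->; rewrite cat_take_drop.
  have qE : q = t ++ v2.
    by apply/eqP; move/eqP: E; rewrite v1E -catA eqseq_cat // eqxx => /andP [].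
  exists (p ++ [:: a; linv a] ++ t), v2; split.
  - by rewrite qE -!catA.
  - by rewrite v1E; apply/rt_step/CancelStep.
  - exact: rt_refl.
- by move=> ->; exists v1, v2; split=> //; apply: rt_refl.
move=> /IH2 [y1 [y2 [/IH1 [x1 [x2 [-> x1y x2y]]] y1v y2v]]].
by exists x1, x2; split=> //; [apply: rt_trans x1y y1v | apply: rt_trans x2y y2v].
Qed.

Lemma reduced_cons a u : reduced (a :: u) = reduced u && (if u is b :: _ then b != linv a else true).
Proof. by case: u => //= b u; rewrite andbC. Qed.

Lemma reduced_catl u v : reduced (u ++ v) -> reduced u.
Proof.
elim: u => // a u IH; rewrite cat_cons !reduced_cons => /andP [/IH ->].
by case: u {IH}.
Qed.

Lemma reduced_catr u v : reduced (u ++ v) -> reduced v.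
Proof. by elim: u => // a u IH; rewrite cat_cons reduced_cons => /andP [/IH]. Qed.

Lemma reduced_glue u m v : m <> [::] -> reduced (u ++ m) -> reduced (m ++ v) ->
  reduced (u ++ m ++ v).
Proof.
move=> m0; elim: u => // a u IH; rewrite !cat_cons !reduced_cons => /andP [um ha] mv.
by rewrite IH //=; case: u ha {IH um} => //=; case: m m0 {mv}.
Qed.

Lemma cyc_reduced_reduced u : cyc_reduced u -> reduced u.
Proof. by case: u => //= a u; rewrite rcons_path => /andP []. Qed.

Lemma max_cancel u v : reduced u -> reduced v ->
  exists c u' v', [/\ u = u' ++ winv c, v = c ++ v' & reduced (u' ++ v')].
Proof.
elim/last_ind: u v => [|u x IH] v ru rv; first by exists [::], [::], v.
have ru' : reduced u by move: ru; rewrite -cats1 => /reduced_catl.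
case: v rv => [|y v] rv; first by exists [::], (rcons u x), [::]; rewrite !cats0.
have [yx|yx] := eqVneq y (linv x); last first.
  exists [::], (rcons u x), (y :: v); split=> //; first by rewrite cats0.
  move: ru; rewrite -cats1 -catA => ru; apply: reduced_glue => //.
  by rewrite cat_cons cat0s reduced_cons rv yx.
have rv' : reduced v by move: rv; rewrite reduced_cons => /andP [].
have [c [u' [v' [-> -> r']]]] := IH v ru' rv'.
exists (y :: c), u', v'; split=> //.
by rewrite winv_cons yx linvK rcons_cat.
Qed.

Lemma red_max_cancel u c v : reduced (u ++ v) -> red ((u ++ winv c) ++ c ++ v) = u ++ v.
Proof.
by move=> uv; rewrite -catA (catA (winv c)) (@red_ctx u v _ [::] (red_winv c)) red_id.
Qed.

End FreeReduction.

(** * Cyclically reduced words over the relators are not trivial *)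

Lemma C'_nat (X : choiceType) (u : set (word X)) (q : nat) : 0 < q ->
  C' (1 / q%:R)%R u ->
  forall R p, symm_closure u R -> prefix p R -> piece u p -> q * size p < size R.
Proof.
move=> q0 hC R p uR pR pp; have := hC R p uR pR pp.
rewrite GRing.mul1r GRing.mulrC Num.Theory.ltr_pdivlMr ?Num.Theory.ltr0n //.
by rewrite -GRing.natrM Num.Theory.ltr_nat mulnC.
Qed.

Section DehnCyclic.
Variables (X : choiceType) (r : set (word X)).

Lemma star_reduced_nat (w : word X) : star_reduced r w <->
  reduced w /\ forall V R, infix V w -> symm_closure r R -> infix V R -> 2 * size V <= size R.
Proof.
have E (a b : nat) : (a%:R / 2%:R < b%:R :> rat)%R = (a < 2 * b).
  by rewrite Num.Theory.ltr_pdivrMr ?Num.Theory.ltr0n // -GRing.natrM Num.Theory.ltr_nat mulnC.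
split=> -[rw H]; split=> //.
  by move=> V R Vw rR VR; rewrite leqNgt; apply/negP => h; apply: H; exists V, R; rewrite E.
by move=> [V [R [Vw rR VR]]]; rewrite E ltnNge H.
Qed.

Lemma cancels_pres_eq u v : cancels u v -> pres_eq r u v.
Proof.
elim=> [x y xy|x|x y z _ xy _ yz].
- exact/asboolP/rst_step/PresCancel.
- exact: pres_eq_refl.
- exact: pres_eq_trans xy yz.
Qed.

Lemma pres_eq_red u v : red u = red v -> pres_eq r u v.
Proof.
move=> uv; apply: (@pres_eq_trans _ _ (red u)); first exact/cancels_pres_eq/cancels_to_red.
by rewrite uv pres_eq_sym; exact/cancels_pres_eq/cancels_to_red.
Qed.

Lemma pres_eq_rot n u : pres_eq r u [::] -> pres_eq r (rot n u) [::].
Proof.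
move=> u1; apply: (@pres_eq_trans _ _ (winv (take n u) ++ take n u)); last exact: pres_eq_Vl.
rewrite /rot; apply: pres_eq_cat; last exact: pres_eq_refl.
apply: (@pres_eq_trans _ _ (winv (take n u) ++ u)).
  rewrite pres_eq_sym -{2}(cat_take_drop n u); apply: pres_eq_red.
  by rewrite catA -[_ ++ drop n u](cat0s) (@red_ctx _ [::] _ _ [::] (red_winv _)).
rewrite -[X in pres_eq _ _ X]cats0; apply: pres_eq_cat => //; exact: pres_eq_refl.
Qed.

Variable q : nat.
Hypothesis hr : relator_set r.
Hypothesis hq : q = 6 \/ (q = 4 /\ T4 r).
Hypothesis hC : forall R p, symm_closure r R -> prefix p R -> piece r p ->
  q * size p < size R.

Lemma rot_cat_ex (u1 u2 : word X) m w : rot m w = u1 ++ u2 -> exists k, rot k w = u2 ++ u1.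
Proof.
move=> E; have [k Ek] := rot_rot_ex (size u1) m w; exists k.
by rewrite -Ek E rot_size_cat.
Qed.

(** If the reduction begins and ends with inverse letters, shifting the word by
    the part that reduces to the first letter makes them cancel. *)
Lemma cyc_reduced_rotation (u : word X) : exists m, cyc_reduced (red (rot m u)).
Proof.
have [n] := ubnP (size (red (rot 0 u))); move: (0) => m; elim: n m => // n IH m mn.
case E : (red (rot m u)) mn => [|a w] mn; first by exists m; rewrite E.
have rw := reduced_red (rot m u); rewrite E in rw.
case: (lastP w) E rw mn => [|w' b] E rw mn.
  by exists m; rewrite E /cyc_reduced /= eq_sym linv_neq.
have [ab|ab] := eqVneq a (linv b); last first.
  by exists m; rewrite E /cyc_reduced /= rcons_path last_rcons /= ab andbT.
have := cancels_to_red (rot m u); rewrite E -[a :: _]/([:: a] ++ rcons w' b).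
move/cancels_split => /(_ _ _ erefl) [u1 [u2 [Eu u1a u2w]]].
have [k Ek] := rot_cat_ex Eu.
apply: (IH k); rewrite Ek; move: mn; rewrite ltnS; apply: leq_trans.
suff -> : red (u2 ++ u1) = w' by rewrite /= size_rcons; lia.
rewrite red_cat (cancels_red u1a) -red_cat (_ : red (u2 ++ [:: a]) = red (rcons w' b ++ [:: a])).
  rewrite cat_rcons ab; have := red_cancel_step (CancelStep w' [::] b).
  rewrite !cats0 => ->; apply: red_id; move: rw; rewrite -cats1.
  by rewrite reduced_cons => /andP [/reduced_catl].
exact: (@red_ctx _ [::] [:: a] u2 _ (cancels_red u2w)).
Qed.

Theorem cyc_star_reduced_neq1 (u : word X) : cyc_star_reduced r u -> ~ pres_eq r u [::].
Proof.
move=> su u1; have [m cw] := cyc_reduced_rotation u.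
have [w0 _] := su m _ (red_free_reduction _).
apply: (cyc_star_reduced_nontrivial hr hq hC w0 cw); last first.
  apply: pres_eq_trans (pres_eq_rot m u1); rewrite pres_eq_sym.
  exact/cancels_pres_eq/cancels_to_red.
move=> n V R /prefixW Vw rR VR.
have cn : cyc_reduced (rot n (red (rot m u))) by rewrite /cyc_reduced rot_cycle.
set w := red (rot m u) in cw w0 Vw cn.
have [x1 [x2 [Eu x1w x2w]]] : exists x1 x2, [/\ rot m u = x1 ++ x2,
    cancels x1 (take n w) & cancels x2 (drop n w)].
  by apply: (cancels_split (cancels_to_red _)); rewrite cat_take_drop.
have [k Ek] := rot_cat_ex Eu.
have Er : red (rot k u) = rot n w.
  rewrite Ek -(red_id (cyc_reduced_reduced cn)) /rot red_cat (cancels_red x1w) -red_cat.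
  exact: (@red_ctx _ [::] (take n w) x2 _ (cancels_red x2w)).
have [_ /star_reduced_nat [_ sR]] := su k _ (red_free_reduction _).
by apply: sR rR VR; rewrite Er.
Qed.

End DehnCyclic.

(** * Words over s *)

Local Open Scope classical_set_scope.

Section WordsOverS.
Variables (X : choiceType) (r s : set (word X)).
Hypothesis hrs : relator_set (r `|` s).
Hypothesis hC : forall R p, symm_closure (r `|` s) R -> prefix p R ->
  piece (r `|` s) p -> 4 * size p < size R.
Hypothesis hdisj : s `&` symm_closure r = set0.
Hypothesis hsinv : forall S, s S -> ~ s (winv S).

Notation T := (@word_letter X s).
Implicit Types (a b : letter s) (w : word s) (B V R : word X).

Lemma symm_closure_mono (u u' : set (word X)) (w : word X) : (forall v, u v -> u' v) ->
  symm_closure u w -> symm_closure u' w.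
Proof. by move=> uu' [v /uu' uv n]; exists v. Qed.

Lemma rot_inv n (w : word X) : exists k, rot k (rot n w) = w.
Proof. by exists (size (rot n w) - n); exact: rotK. Qed.

Lemma word_letter_linv a : T (linv a) = winv (T a).
Proof. by rewrite /word_letter; case: a => x [] //=; rewrite winvK. Qed.

Lemma word_letter_symm a : symm_closure s (T a).
Proof.
case: a => x b; rewrite /word_letter /=; have xs : s (val x) by apply: set_valP.
by case: b; [|apply: symm_closure_inv]; apply: symm_closure_mem.
Qed.

Lemma word_letter_symmU a : symm_closure (r `|` s) (T a).
Proof. by apply: symm_closure_mono (word_letter_symm a) => v; right. Qed.

(** This is where distinct formal letters give distinct elements of the
    symmetrised closure, which the definition of a piece requires. *)
Lemma word_letter_inj : injective T.
Proof.
move=> [x b] [y c]; rewrite /word_letter /=.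
have xs : s (val x) by apply: set_valP. have ys : s (val y) by apply: set_valP.
case: b c => [] [] E.
- by rewrite (val_inj E).
- by case: (hsinv ys); rewrite -E.
- by case: (hsinv xs); rewrite E.
- by have /val_inj -> : val x = val y by rewrite -[val x]winvK E winvK.
Qed.

Lemma rot_word_letter_not_relator a n R : symm_closure r R -> rot n (T a) <> R.
Proof.
move=> rR E; have [k Ek] := rot_inv n (T a).
have rT : symm_closure r (T a) by rewrite -Ek E; apply: symm_closure_rot.
have ra : symm_closure r (val a.1).
  case: a rT {E Ek} => x [] // /symm_closure_inv; by rewrite /word_letter /= winvK.
have : (s `&` symm_closure r) (val a.1) by split=> //; exact: set_valP.
by rewrite hdisj.
Qed.

Lemma word_letter_cyc_reduced a : cyc_reduced (T a).
Proof. exact: symm_closure_cyc_reduced hrs _ (word_letter_symmU a). Qed.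

Lemma word_letter_reduced a : reduced (T a).
Proof. exact/cyc_reduced_reduced/word_letter_cyc_reduced. Qed.

Lemma word_letter_size a : 0 < size (T a).
Proof.
rewrite lt0n size_eq0; apply/eqP; exact: symm_closure_neq0 hrs _ (word_letter_symmU a).
Qed.

(** Cyclic shifts are allowed, since a single letter read from its middle is one
    of the words to be considered. *)
Definition fits B := exists a n, infix B (rot n (T a)).
Definition long B := exists a n, infix B (rot n (T a)) /\ size (T a) < 2 * size B.

Lemma infix_rot_prefix B (w : word X) : infix B w -> exists n, prefix B (rot n w).
Proof.
move=> /infixP [x [y ->]]; exists (size x).
by rewrite rot_size_cat -catA prefix_prefix.
Qed.

(** A non-empty V is a piece, since the cyclic shift of T a and the relator that
    begin with it are distinct. *)
Lemma overlap_lt V a n R : infix V (rot n (T a)) -> symm_closure r R -> infix V R ->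
  4 * size V < size (T a) /\ 4 * size V < size R.
Proof.
move=> VT rR VR.
have R0 : 0 < size R.
  rewrite lt0n size_eq0; apply/eqP; apply: (symm_closure_neq0 hrs).
  by apply: symm_closure_mono rR => v; left.
have [->|/eqP V0] := eqVneq V [::]; first by rewrite muln0 word_letter_size.
have [i Ti] := infix_rot_prefix VT; have [j Rj] := infix_rot_prefix VR.
have symT : symm_closure (r `|` s) (rot i (rot n (T a))).
  exact/symm_closure_rot/symm_closure_rot/word_letter_symmU.
have symR' := symm_closure_rot j rR.
have symR : symm_closure (r `|` s) (rot j R).
  by apply: symm_closure_mono symR' => v; left.
have pV : piece (r `|` s) V.
  split=> //; exists (rot i (rot n (T a))), (rot j R); split=> //.
  have [k ->] := rot_rot_ex i n (T a); exact: rot_word_letter_not_relator.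
have := hC symT Ti pV; have := hC symR Rj pV.
by rewrite !size_rot.
Qed.

Lemma common_prefix_lt c a b : prefix c (T a) -> prefix c (T b) -> a != b ->
  4 * size c < size (T a) /\ 4 * size c < size (T b).
Proof.
move=> ca cb ab.
have [->|/eqP c0] := eqVneq c [::]; first by rewrite muln0 !word_letter_size.
have pc : piece (r `|` s) c.
  split=> //; exists (T a), (T b); split=> //; try exact: word_letter_symmU.
  by move/word_letter_inj/eqP; apply/negP.
by split; apply: hC => //; exact: word_letter_symmU.
Qed.

(** The factors that survive in a product; the last one is a trace of a prefix
    and may be short or empty. *)
Fixpoint chain (L : seq (word X)) : Prop :=
  if L is B :: L' then (if L' is [::] then fits B else long B) /\ chain L' else True.

Lemma long_fits B : long B -> fits B.
Proof. by move=> [a [n [? _]]]; exists a, n. Qed.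

Lemma chain_cons B L : long B -> chain L -> chain (B :: L).
Proof. by case: L => [|B' L] lB cL //=; split=> //; apply: long_fits. Qed.

Lemma infix_cat_split V (A B : word X) : infix V (A ++ B) ->
  [\/ infix V A, infix V B | exists V1 V2, [/\ V = V1 ++ V2, infix V1 A & prefix V2 B]].
Proof.
move=> /infixP H; have {H} [x [y E]] : exists x y : word X, A ++ B = x ++ V ++ y by [].
have sE := congr1 size E; rewrite !size_cat in sE.
have EA : A = take (size A) (x ++ V ++ y) by rewrite -E take_size_cat.
have EB : B = drop (size A) (x ++ V ++ y) by rewrite -E drop_size_cat.
have [sx|xs] := leqP (size A) (size x).
  constructor 2; apply/infixP; exists (drop (size A) x), y.
  rewrite {1}EB drop_cat; case: ifP => // /negbT; rewrite -leqNgt => xs.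
  by have -> : size A = size x; [lia|rewrite subnn drop0 drop_size].
have [sy|ys] := leqP (size B) (size y).
  constructor 1; apply/infixP; exists x, (take (size A - size x - size V) y).
  rewrite {1}EA take_cat ltnNge ltnW //= take_cat; case: ifP => // sV; lia.
constructor 3; exists (take (size A - size x) V), (drop (size A - size x) V).
rewrite cat_take_drop; split=> //.
  apply/infixP; exists x, [::]; rewrite cats0.
  by rewrite {1}EA take_cat ltnNge ltnW //= takel_cat //; lia.
apply/prefixP; exists y.
rewrite {1}EB drop_cat ltnNge ltnW //= drop_cat; case: ifP => // sV; lia.
Qed.

(** V cannot contain a long factor, so it lies on two consecutive ones and is cut
    into two pieces. *)
Lemma chain_overlap B L V R : fits B -> chain L -> infix V (flatten (B :: L)) ->
  symm_closure r R -> infix V R -> 2 * size V <= size R.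
Proof.
elim: L B => [|B1 L IH] B fB cL VBL rR VR.
  move: fB VBL => [a [n Ba]]; rewrite /= cats0 => VB.
  have [] := overlap_lt (infix_trans VB Ba) rR VR; lia.
move: VBL; rewrite [flatten _]/(B ++ flatten (B1 :: L)).
have fB1 : fits B1 by move: cL => /=; case: L {IH} => [[] //|? ?] [/long_fits].
case/infix_cat_split => [VB|VL|[V1 [V2 [VE V1B V2L]]]].
- case: fB => a [n Ba]; have [] := overlap_lt (infix_trans VB Ba) rR VR; lia.
- by apply: (IH B1) VL rR VR => //; case: cL.
have V1R : infix V1 R by apply: infix_trans VR; rewrite VE prefix_infix.
have V2R : infix V2 R by apply: infix_trans VR; rewrite VE suffix_infix.
have [a [n Ba]] := fB; have [_ V1s] := overlap_lt (infix_trans V1B Ba) rR V1R.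
have [b [m Bb]] := fB1.
have [sV|sV] := leqP (size V2) (size B1).
  have V2B : prefix V2 B1.
    case/prefixP: V2L => t Et; apply/prefixP; exists (take (size B1 - size V2) t).
    have EB : B1 = take (size B1) (V2 ++ t) by rewrite -Et /= take_size_cat.
    by rewrite {1}EB take_cat ltnNge sV.
  have [_] := overlap_lt (infix_trans (prefixW V2B) Bb) rR V2R.
  by rewrite VE size_cat; lia.
have B1V : prefix B1 V2.
  case/prefixP: V2L => t Et; apply/prefixP; exists (drop (size B1) V2).
  have EB : B1 = take (size B1) (V2 ++ t) by rewrite -Et /= take_size_cat.
  by rewrite {1}EB takel_cat ?cat_take_drop // ltnW.
case: L cL V2L {IH} => [|B2 L] cL V2L.
  by move: sV; have := size_prefix V2L; rewrite /= cats0 leqNgt => /negbTE ->.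
case: cL => -[c [k [Bc lc]]] _.
have [] := overlap_lt Bc rR (infix_trans (prefixW B1V) V2R); lia.
Qed.

Lemma fits_infix c u u' a : T a = u ++ c ++ u' -> fits c.
Proof. by move=> ca; exists a, 0; rewrite rot0 ca infix_infix. Qed.

Lemma expand_cons a w : expand (a :: w) = T a ++ expand w. Proof. by []. Qed.

Lemma expand_cat (w w' : word s) : expand (w ++ w') = expand w ++ expand w'.
Proof. by rewrite /expand map_cat flatten_cat. Qed.

Lemma cancel_prefix_lt (m c t : word X) a b : T a = m ++ winv c -> prefix (c ++ t) (T b) ->
  b != linv a -> 4 * size c < size (T a) /\ 4 * size c < size (T b).
Proof.
move=> Ta cb ba.
have ca : prefix c (T (linv a)).
  by rewrite word_letter_linv Ta winv_cat winvK prefix_prefix.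
have cb' : prefix c (T b) by apply: prefix_trans cb; apply: prefix_prefix.
have [] := common_prefix_lt ca cb' _; first by rewrite eq_sym.
by rewrite word_letter_linv size_winv.
Qed.

Lemma prefix_reduced (c : word X) b : prefix c (T b) -> reduced c.
Proof. by move=> /prefixP [t Tb]; have := word_letter_reduced b; rewrite Tb => /reduced_catl. Qed.

(** A word that loses less than a quarter at each end keeps more than half. *)
Lemma long_middle (m c m' c' : word X) a : T a = m ++ c -> m = c' ++ m' ->
  4 * size c < size (T a) -> 4 * size c' < size (T a) -> long m' /\ m' <> [::].
Proof.
move=> Ta mE cl cl'.
have sE : size (T a) = size c' + size m' + size c by rewrite Ta mE !size_cat.
have arith t x y z : t = x + y + z -> 4 * z < t -> 4 * x < t -> t < 2 * y by lia.
have lm := arith _ _ _ _ sE cl cl'.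
split; last by move=> m0; rewrite m0 in lm.
by exists a, 0; split; [rewrite rot0 Ta mE -catA infix_infix|exact: lm].
Qed.

(** The first factor m is a prefix of T a whose left end is still intact, so that
    a letter put in front of it can cancel into it. *)
Lemma red_expand_tail w a b (Q : word X) : reduced (a :: w ++ [:: b]) -> prefix Q (T b) ->
  exists m c L, [/\ T a = m ++ c, 4 * size c < size (T a), chain L,
    red (expand (a :: w) ++ Q) = m ++ flatten L & reduced (m ++ flatten L)].
Proof.
elim: w a => [|a2 w IH] a rw Qb.
  have [c [m [Q' [Ta QE rmQ]]]] := max_cancel (word_letter_reduced a) (prefix_reduced Qb).
  have ba : b != linv a by move: rw => /= /andP [].
  have [cl _] := cancel_prefix_lt Ta (eq_ind _ (fun z => prefix z (T b)) Qb _ QE) ba.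
  exists m, (winv c), [:: Q']; rewrite size_winv /= !cats0; split=> //.
    split=> //; case/prefixP: Qb => t Tb; apply: (@fits_infix _ c t b).
    by rewrite Tb QE catA.
  by rewrite expand_cons /= cats0 {1}Ta QE red_max_cancel.
have ba : a2 != linv a by move: rw => /= /andP [].
have [m2 [c2 [L [Ta2 c2l cL E2 r2]]]] : exists m c L, [/\ T a2 = m ++ c, 4 * size c < size (T a2), chain L,
    red (expand (a2 :: w) ++ Q) = m ++ flatten L & reduced (m ++ flatten L)].
  by apply: IH Qb; move: rw => /= /andP [].
have m2p : prefix m2 (T a2) by rewrite Ta2 prefix_prefix.
have [c [m [m2' [Ta m2E rmm]]]] := max_cancel (word_letter_reduced a) (prefix_reduced m2p).
have [cl cl2] := cancel_prefix_lt Ta (eq_ind _ (fun z => prefix z (T a2)) m2p _ m2E) ba.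
have [lm m0] := long_middle Ta2 m2E c2l cl2.
have r3 : reduced (m ++ m2' ++ flatten L).
  by apply: reduced_glue => //; move: r2; rewrite m2E -catA => /reduced_catr.
exists m, (winv c), (m2' :: L); rewrite size_winv; split=> //.
  exact: chain_cons.
rewrite expand_cons -catA -[T a ++ _]cats0 -catA.
rewrite (@red_ctx _ (T a) [::] _ (m2 ++ flatten L)) ?cats0; last by rewrite E2 red_id.
by rewrite Ta m2E -!(catA c) red_max_cancel.
Qed.

Definition red_star_reduced (u : word X) := red u <> [::] /\ star_reduced r (red u).

Lemma red_star_reduced_red (u u' : word X) : red u = red u' -> red_star_reduced u' -> red_star_reduced u.
Proof. by rewrite /red_star_reduced => ->. Qed.

Lemma chain_red_star_reduced (u B : word X) L : red u = flatten (B :: L) -> red u <> [::] ->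
  fits B -> chain L -> red_star_reduced u.
Proof.
move=> uE u0 fB cL; split=> //; apply/star_reduced_nat; split; first exact: reduced_red.
by move=> V R; rewrite uE; apply: chain_overlap.
Qed.

(** The general product: a suffix P of a letter, at least one full letter, and a
    prefix Q of a letter. *)
Lemma red_star_reduced_between a0 w b (P u Q : word X) : w <> [::] -> reduced (a0 :: w ++ [:: b]) ->
  T a0 = u ++ P -> prefix Q (T b) -> red_star_reduced (P ++ expand w ++ Q).
Proof.
case: w => // a w _ rw TP Qb.
have ra : reduced (a :: w ++ [:: b]) by move: rw => /= /andP [].
have aa : a != linv a0 by move: rw => /= /andP [].
have [m [c [L [Ta cl cL E r1]]]] := red_expand_tail ra Qb.
have mp : prefix m (T a) by rewrite Ta prefix_prefix.
have rP : reduced P by have := word_letter_reduced a0; rewrite TP => /reduced_catr.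
have [c' [P' [m' [PE mE rPm]]]] := max_cancel rP (prefix_reduced mp).
have Ta0 : T a0 = (u ++ P') ++ winv c' by rewrite TP PE catA.
have [_ cl'] := cancel_prefix_lt Ta0 (eq_ind _ (fun z => prefix z (T a)) mp _ mE) aa.
have [lm m0] := long_middle Ta mE cl cl'.
have r3 : reduced (P' ++ m' ++ flatten L).
  by apply: reduced_glue => //; move: r1; rewrite mE -catA => /reduced_catr.
have Er : red (P ++ expand (a :: w) ++ Q) = flatten (P' :: m' :: L).
  rewrite -[P ++ _]cats0 -catA (@red_ctx _ P [::] _ (m ++ flatten L)) ?cats0; last by rewrite E red_id.
  by rewrite PE mE -!(catA c') red_max_cancel.
apply: (chain_red_star_reduced Er).
- by rewrite Er /=; case: (P') (m') m0 => [|? ?] [].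
- apply: (@fits_infix _ u (winv c') a0); by rewrite TP PE.
- exact: chain_cons.
Qed.

(** A cyclic shift of the expansion begins and ends inside a letter a.  If the
    letters that have become adjacent are inverse they disappear; when nothing
    is left on one side, the inverse letter cancels against a part of a, and the
    end becomes a part of the inverse of a instead. *)
Lemma red_star_reduced_rotation w1 a w2 (t1 t2 : word X) : reduced (w1 ++ a :: w2) -> T a = t1 ++ t2 ->
  red_star_reduced (t2 ++ expand w2 ++ expand w1 ++ t1).
Proof.
move=> + Ta; have T' : T (linv a) = winv t2 ++ winv t1 by rewrite word_letter_linv Ta winv_cat.
have Ka : linv (linv a) = a by case: (a) => x b; rewrite /linv /= negbK.
have Kb (b b' : letter s) : (b == linv b') = (b' == linv b).
  by apply/eqP/eqP => ->; [case: b' | case: b] => x c; rewrite /linv /= negbK.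
have pt : prefix t1 (T a) by rewrite Ta prefix_prefix.
have [n] := ubnP (size w1); elim: n w1 w2 => // n IH w1 w2 n1 rw.
have ra2 : reduced (a :: w2) by apply: reduced_catr rw.
have r1a : reduced (w1 ++ [:: a]).
  by move: rw; rewrite -[a :: w2]cat1s catA => /reduced_catl.
have nil_rot : red_star_reduced (t2 ++ t1).
  have rT : reduced (t2 ++ t1).
    apply: cyc_reduced_reduced; rewrite -(rot_size_cat t1) -Ta /cyc_reduced rot_cycle.
    exact: word_letter_cyc_reduced.
  apply: (@chain_red_star_reduced _ (t2 ++ t1) [::]) => //.
  - by rewrite red_id //= cats0.
  - rewrite red_id // => /(congr1 size); rewrite size_cat addnC -size_cat -Ta => T0.
    by have := word_letter_size a; rewrite T0.
  - by exists a, (size t1); rewrite Ta rot_size_cat infix_refl.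
have glue (v : word s) : v <> [::] -> reduced (a :: v ++ [:: a]) -> red_star_reduced (t2 ++ expand v ++ t1).
  by move=> v0 rv; apply: red_star_reduced_between v0 rv Ta pt.
case: (lastP w2) rw ra2 => [|w2' b'] rw ra2.
  case: w1 n1 rw r1a => [|b w1] n1 rw r1a //.
  have [ba|ba] := eqVneq b (linv a); last first.
    rewrite cat0s; apply: glue => //.
    by rewrite reduced_cons r1a /= ba.
  have w10 : w1 <> [::] by move=> w0; move: r1a; rewrite w0 ba /= Ka eqxx.
  apply: (@red_star_reduced_red _ (winv t1 ++ expand w1 ++ t1)); last first.
    by apply: (red_star_reduced_between w10 _ T' pt); rewrite -ba.
  rewrite cat0s expand_cons ba T' -!catA (catA t2).
  exact: (@red_ctx _ [::] (winv t1 ++ expand w1 ++ t1) _ [::] (red_winvr t2)).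
case: w1 n1 rw r1a => [|b w1] n1 rw r1a.
  have [ba|ba] := eqVneq b' (linv a); last first.
    rewrite cat0s; apply: glue; first by case: (w2').
    rewrite -cats1 -catA -cat_cons; apply: reduced_glue => //; first by rewrite cat_cons cats1.
    by rewrite /= Kb ba.
  have w20 : w2' <> [::] by move=> w0; move: ra2; rewrite w0 ba /= eqxx.
  apply: (@red_star_reduced_red _ (t2 ++ expand w2' ++ winv t2)); last first.
    apply: (red_star_reduced_between w20 _ Ta _ (b := linv a)).
      by rewrite cats1 -ba.
    by rewrite T' prefix_prefix.
  rewrite cat0s -cats1 expand_cat expand_cons cats0 ba T' -!catA.
  have := @red_ctx _ (t2 ++ expand w2' ++ winv t2) [::] _ [::] (red_winv t1).
  by rewrite !cats0 -!catA.
have [bb|bb] := eqVneq b (linv b').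
  have rw' : reduced (w1 ++ a :: w2').
    move: rw; rewrite cat_cons -[b :: _]cat1s => /reduced_catr.
    by rewrite -cats1 -cat_cons catA => /reduced_catl.
  apply: (@red_star_reduced_red _ (t2 ++ expand w2' ++ expand w1 ++ t1)); last exact: IH rw'.
  rewrite -cats1 expand_cat (expand_cons b) (expand_cons b') cats0 bb word_letter_linv.
  have := @red_ctx _ (t2 ++ expand w2') (expand w1 ++ t1) _ [::] (red_winvr (T b')).
  by rewrite -!catA.
rewrite (catA (expand (rcons _ _))) -expand_cat.
apply: glue; first by case: (w2').
rewrite -cats1 -!catA -cat_cons; apply: reduced_glue => //; first by rewrite cat_cons cats1.
by rewrite cat1s reduced_cons r1a /= bb.
Qed.

Lemma expand_split w n : n < size (expand w) -> exists w1 a w2 t1 t2,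
  [/\ w = w1 ++ a :: w2, T a = t1 ++ t2, take n (expand w) = expand w1 ++ t1 &
      drop n (expand w) = t2 ++ expand w2].
Proof.
elim: w n => // a w IH n; rewrite expand_cons size_cat => nw.
have [na|an] := ltnP n (size (T a)).
  exists [::], a, w, (take n (T a)), (drop n (T a)); split=> //.
  - by rewrite cat_take_drop.
  - by rewrite takel_cat // ltnW.
  - by rewrite drop_cat na.
have [|w1 [b [w2 [t1 [t2 [wE Tb tE dE]]]]]] := IH (n - size (T a)).
  by rewrite ltn_subLR.
exists (a :: w1), b, w2, t1, t2; split=> //.
- by rewrite wE.
- by rewrite take_cat ltnNge an /= tE expand_cons catA.
- by rewrite drop_cat ltnNge an /= dE.
Qed.

Theorem expand_cyc_star_reduced w : w <> [::] -> reduced w -> cyc_star_reduced r (expand w).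
Proof.
move=> w0 rw n v /free_reduction_red ->.
suff H m : m < size (expand w) -> red_star_reduced (rot m (expand w)).
  have [/H //|nw] := ltnP n (size (expand w)).
  rewrite rot_oversize // -[expand w]rot0; apply: H.
  case: w w0 {rw nw} => // a w _; rewrite expand_cons size_cat.
  by have := word_letter_size a; case: (size _).
move=> /expand_split [w1 [a [w2 [t1 [t2 [wE Ta tE dE]]]]]].
rewrite /rot tE dE -catA; apply: red_star_reduced_rotation Ta; by rewrite -wE.
Qed.

End WordsOverS.

(** * Freeness of the subgroup generated by s *)

Local Open Scope group_scope.

Section FreeBasis.
Variables (X : choiceType) (r s : set (word X)).
Implicit Types (w : word s) (a : letter s).

Notation H := (subgroup_gen [set pres_class r S | S in s]).
Notation cl w := (pres_class r (expand w)).

Lemma expand_winv w : expand (winv w) = winv (expand w).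
Proof.
elim: w => // a w IH; rewrite winv_cons -cats1 expand_cat IH expand_cons winv_cat.
by rewrite expand_cons cats0 word_letter_linv.
Qed.

Lemma cl_cat (w w' : word s) : cl (w ++ w') = cl w * cl w'.
Proof. by rewrite expand_cat -pres_class_cat. Qed.

Lemma cl_winv w : cl (winv w) = (cl w)^-1.
Proof. by rewrite expand_winv -pres_class_inv. Qed.

Lemma mem_subgroup_gen g : H g <-> exists w, g = cl w.
Proof.
split.
  move=> Hg; apply: (Hg [set g | exists w, g = cl w]); split => /=; last first.
    move=> _ [S sS <-]; exists [:: (exist _ S (mem_set sS), true)].
    by rewrite /expand /= cats0.
  split; first by exists [::].
  - by move=> _ _ [w ->] [w' ->]; exists (w ++ w'); rewrite cl_cat.
  - by move=> _ [w ->]; exists (winv w); rewrite cl_winv.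
move=> [w ->] K [/= [K1 KM KV] sK]; elim: w => // a w IH.
rewrite -cat1s cl_cat; apply: KM => //; rewrite expand_cons cats0 /word_letter.
have Ka : K (pres_class r (val a.1)) by apply: sK; exists (val a.1) => //; exact: set_valP.
by case: a.2 => //; rewrite -pres_class_inv; apply: KV.
Qed.

Hypothesis free : forall w, w <> [::] -> reduced w -> cl w <> 1.

Section Extension.
Variables (K : groupType) (f : s -> K).

Definition ev_letter a : K := if a.2 then f a.1 else (f a.1)^-1.
Definition ev w : K := foldr (fun a k => ev_letter a * k) 1 w.

Lemma ev_cat (w w' : word s) : ev (w ++ w') = ev w * ev w'.
Proof. by elim: w => [|a w /= ->]; rewrite ?mul1g ?mulgA. Qed.

Lemma ev_letter_linv a : ev_letter (linv a) = (ev_letter a)^-1.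
Proof. by rewrite /ev_letter; case: a => x [] //=; rewrite invgK. Qed.

Lemma ev_winv w : ev (winv w) = (ev w)^-1.
Proof.
elim: w => [|a w IH]; first by rewrite invg1.
by rewrite winv_cons -cats1 ev_cat IH /= mulg1 ev_letter_linv -invgM.
Qed.

Lemma ev_cancels (w w' : word s) : cancels w w' -> ev w = ev w'.
Proof.
elim=> [_ _ [p q a]|//|x y z _ -> _ -> //].
by rewrite !ev_cat /= ev_letter_linv mulg1 mulgV mul1g.
Qed.

Lemma cl_cancels (w w' : word s) : cancels w w' -> cl w = cl w'.
Proof.
elim=> [_ _ [p q a]|//|x y z _ -> _ -> //].
rewrite !cl_cat -cat1s cl_cat (_ : [:: linv a] = winv [:: a]) // cl_winv.
by rewrite mulgV mul1g.
Qed.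

(** If two words have the same class then their quotient is trivial, so it reduces
    to the empty word. *)
Lemma ev_well_defined (w w' : word s) : cl w = cl w' -> ev w = ev w'.
Proof.
move=> ww'; have c1 := cancels_to_red (w ++ winv w').
have cl1 : cl (red (w ++ winv w')) = 1.
  by rewrite -(cl_cancels c1) cl_cat cl_winv ww' mulgV.
have [r0|/eqP r0] := eqVneq (red (w ++ winv w')) [::]; last first.
  by case: (free r0 (reduced_red _)).
have := ev_cancels c1; rewrite r0 ev_cat ev_winv => /(congr1 (fun k => k * ev w')).
by rewrite mulgVK mul1g.
Qed.

Definition extend (g : presented r) : K :=
  if pselect (exists w, g = cl w) is left p then ev (projT1 (cid p)) else 1.

Lemma extendE w : extend (cl w) = ev w.
Proof.
rewrite /extend; case: pselect => [p|]; last by case; exists w.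
by apply: ev_well_defined; rewrite -(projT2 (cid p)).
Qed.

End Extension.

(** Existence of the extension is the well-definedness of the evaluation of words
    over s; uniqueness holds because the classes of these words form the subgroup. *)
Theorem free_basis : free_with_basis H (fun S : s => pres_class r (val S)).
Proof.
have gen1 (S : s) : pres_class r (val S) = cl [:: (S, true)].
  by rewrite /expand /= cats0.
split; first by move=> S; apply/mem_subgroup_gen; exists [:: (S, true)]; exact: gen1.
move=> K f; split.
  exists (extend f); split; last by move=> S; rewrite gen1 extendE /= mulg1.
  move=> x y; rewrite !in_setE => /mem_subgroup_gen [w ->] /mem_subgroup_gen [w' ->].
  by rewrite -cl_cat !extendE ev_cat.
suff ext (phi : presented r -> K) : {in H &, {morph phi : x y / x * y}} ->
    (forall S : s, phi (pres_class r (val S)) = f S) -> forall w, phi (cl w) = ev f w.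
  move=> phi psi pM pf qM qf g; rewrite in_setE => /mem_subgroup_gen [w ->].
  by rewrite !ext.
move=> pM pf.
have inH w : cl w \in H by rewrite in_setE; apply/mem_subgroup_gen; exists w.
have pcat (w w' : word s) : phi (cl (w ++ w')) = phi (cl w) * phi (cl w').
  by rewrite cl_cat pM.
have p1 : phi (cl ([::] : word s)) = 1.
  by apply: (mulIg (phi (cl ([::] : word s)))); rewrite mul1g -pcat.
have pV w : phi (cl (winv w)) = (phi (cl w))^-1.
  apply: (mulIg (phi (cl w))); rewrite mulVg -pcat -p1; congr phi.
  by rewrite cl_cat cl_winv mulVg.
elim=> // a w IH; rewrite -cat1s pcat IH /=; congr (_ * _).
case: a => S [|]; rewrite /ev_letter /=; first by rewrite -gen1 pf.
by rewrite -[[:: _]]/(winv [:: (S, true)]) pV -gen1 pf.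
Qed.

End FreeBasis.

Local Close Scope group_scope.
Local Open Scope ring_scope.

(* hdisj and hsinv are implicit in the notations <x; r, s> and s^{+-1}: no
   element of s is already a relator of r (up to cyclic shift and inversion),
   and the symbols s and s^-1 are distinct.  Both follow from the conclusion. *)
Theorem lemma6p3 (X : countType) (r s : set (word X))
    (hr : relator_set r)
    (hrC : C' (1 / 6%:R) r \/ (C' (1 / 4%:R) r /\ T4 r))
    (hrs : relator_set (r `|` s))
    (hrsC : C' (1 / 4%:R) (r `|` s))
    (hdisj : s `&` symm_closure r = set0)
    (hsinv : forall S, s S -> ~ s (winv S)) :
  (forall w : word s, w <> [::] -> reduced w -> cyc_star_reduced r (expand w))
  /\
  free_with_basis
    (subgroup_gen [set pres_class r S | S in s])
    (fun S : s => pres_class r (val S)).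
Proof.
have star (w : word s) : w <> [::] -> reduced w -> cyc_star_reduced r (expand w).
  exact: (expand_cyc_star_reduced hrs (C'_nat _ hrsC) hdisj hsinv).
split=> //; apply: free_basis => w w0 rw w1.
have triv : pres_eq r (expand w) [::] by apply/pres_classP.
case: hrC => [h6|[h4 t4]].
  exact: (cyc_star_reduced_neq1 hr (or_introl erefl) (C'_nat _ h6) (star w w0 rw) triv).
exact: (cyc_star_reduced_neq1 hr (or_intror (conj erefl t4)) (C'_nat _ h4) (star w w0 rw) triv).
Qed.
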